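(* For every positive integer $t$, the following statements hold. (a) For every integer $d\ge2$, every $td(d+1)$-connected graph contains $t$ pairwise edge-disjoint $d$-rigid spanning subgraphs. The connectivity bound is best possible: there exists a $(td(d+1)-1)$-connected graph that does not contain $t$ pairwise edge-disjoint $d$-rigid spanning subgraphs. (b) For every positive integer $k$, every $tk(k+1)$-connected graph contains $t$ pairwise edge-disjoint $k$-connected spanning subgraphs. Consequently, $f^{*}(k)\le k(k+1)$, where $f^{*}(k)$ is the least integer such that, for every positive integer $t$, every $t f^{*}(k)$-connected graph contains $t$ pairwise edge-disjoint $k$-connected spanning subgraphs.
   Context: All graphs are finite and simple. For a positive integer $k$, a graph $G$ is $k$-connected if $|V(G)|\ge k+1$ and $G-S$ is connected for every $S\subseteq V(G)$ with $|S|<k$. Rigidity: let $K(V)$ be the complete graph on a finite vertex set $V$. A $d$-dimensional realization is a map $p:V\to\mathbb{R}^d$; it is generic if its $d|V|$ coordinates are algebraically independent over $\mathbb{Q}$. The rigidity matrix $R(G,p)$ of a graph $G$ on $V$ has one row for each edge $uv$ and $d$ columns for each vertex; the row of $uv$ has $p(u)-p(v)$ in the columns of $u$, $p(v)-p(u)$ in the columns of $v$, and zeros elsewhere. The $d$-dimensional generic rigidity matroid $\mathcal{R}_d(K(V))$ is the row matroid of $R(K(V),p)$ for generic $p$ (independent of the choice of generic $p$), and $r_d$ denotes its rank function. For a graph $H=(V,E_H)$ put $r_d(H)=r_d(E_H)$. The graph $H$ is $d$-rigid if $r_d(H)=r_d(K(V))$. *)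

(* Defs.v *)
From HB Require Import structures.
From mathcomp Require Import all_boot all_order all_algebra.
From mathcomp Require Import boolp classical_sets reals.
From mathcomp Require Import -(notations) mpoly.

Set Implicit Arguments.
Unset Strict Implicit.
Unset Printing Implicit Defensive.

Import GRing.Theory Num.Theory.

Local Open Scope ring_scope.

(* Finite simple graphs on V; edges are the two-element subsets of V. *)
Record sgraph (V : finType) := SGraph {
  edges : {set {set V}};
  edges_card2 : [forall e in edges, #|e| == 2%N]
}.

Definition adj (V : finType) (G : sgraph V) : rel V :=
  fun u v => [set u; v]%SET \in edges G.

Definition complete_edges (V : finType) : {set {set V}} :=
  [set e : {set V} | #|e| == 2%N]%SET.

(* Connectedness of G - S; nonemptiness of G - S is not included, but in
   [kconnected] it follows from #|S| < k < #|V|. *)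
Definition connected_minus (V : finType) (G : sgraph V) (S : {set V}) : Prop :=
  forall x y : V, x \notin S -> y \notin S ->
    connect [rel u v | [&& adj G u v, u \notin S & v \notin S]] x y.

Definition kconnected (k : nat) (V : finType) (G : sgraph V) : Prop :=
  (k < #|V|)%N /\
  forall S : {set V}, (#|S| < k)%N -> connected_minus G S.

Definition has_disjoint_spanning (t : nat) (V : finType)
    (P : sgraph V -> Prop) (G : sgraph V) : Prop :=
  exists H : 'I_t -> sgraph V,
    [/\ forall i, edges (H i) \subset edges G,
        forall i j, i != j -> [disjoint edges (H i) & edges (H j)]
      & forall i, P (H i)].

Section Rigidity.
Variables (R : realType) (d : nat) (V : finType).

Definition alg_independent (n : nat) (x : 'I_n -> R) : Prop :=
  forall q : mpoly n rat, mmap (@ratr R) x q = 0 -> q = 0.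

Definition generic (p : V -> 'rV[R]_d) : Prop :=
  alg_independent (fun c : 'I_#|{: V * 'I_d}| =>
    p (enum_val c).1 0 (enum_val c).2).

(* For e = {u, v}, the sum over e in column (u, i) is
   (p u i - p u i) + (p u i - p v i) = p u i - p v i. *)
Definition rigidity_mx (E : {set {set V}}) (p : V -> 'rV[R]_d) :
    'M[R]_(#|E|, #|{: V * 'I_d}|) :=
  \matrix_(r < #|E|, c < #|{: V * 'I_d}|)
    let e : {set V} := enum_val r in
    let: (w, i) := enum_val c in
    if w \in e then \sum_(v in e) (p w 0 i - p v 0 i) else 0.

(* Generic realizations exist because R is uncountable, so the default value
   of [xget] is never used; the rank below does not depend on the choice. *)
Definition generic_realization : V -> 'rV[R]_d :=
  xget (fun=> 0) [set p | generic p]%classic.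

Definition generic_rank (E : {set {set V}}) : nat :=
  \rank (rigidity_mx E generic_realization).

Definition rigid (H : sgraph V) : Prop :=
  generic_rank (edges H) = generic_rank (complete_edges V).

End Rigidity.

Definition fstar_bound (k m : nat) : Prop :=
  forall t : nat, (0 < t)%N -> forall (V : finType) (G : sgraph V),
    kconnected (t * m) G -> has_disjoint_spanning t (@kconnected k V) G.

(* "m = f*(k)".  Only positive candidates are considered, since j-connectivity
   is a notion for positive j. *)
Definition is_fstar (k m : nat) : Prop :=
  [/\ (0 < m)%N, fstar_bound k m
    & forall n : nat, (0 < n)%N -> fstar_bound k n -> (m <= n)%N].

(* Main.v *)
From HB Require Import structures.
Require Import Defs.
From mathcomp Require Import all_boot all_order all_algebra.
From mathcomp Require Import reals.
From mathcomp Require boolp classical_sets functions cardinality set_interval.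
From mathcomp Require ereal lebesgue_measure.
From mathcomp Require Import -(notations) mpoly.
From mathcomp Require Import zify ring lra.

(** By Edmonds' base packing theorem, [t] edge-disjoint [d]-rigid spanning
    subgraphs exist once [t * r K <= #|E :\: H| + t * r H] for every set [H] of
    edges that is closed in the rigidity matroid; one may add [H] to [E].  Insert
    the vertices in a random order.  When [v] arrives with a set [M] of earlier
    [H]-neighbours, the rank of [H] grows by at least [min(d, #|M|)]
    (0-extension), and by at least [d + 1] if [#|M| > d] and [M] is not a clique
    of [H] (1-extension, as [H] is closed).  Averaging gives a lower bound for
    [r H] that is a sum over vertices.  If [v] has small [H]-degree, then its
    edges outside [H], each counted with weight [1 / (2 t)], compensate the loss
    with respect to [d].  If its [H]-degree is at least [t d (d + 1)], then either
    its [H]-neighbourhood is not a clique, and 1-extensions suffice, or one edge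
    outside [H] suffices; a vertex with a clique neighbourhood and no edge outside
    [H] can be deleted without destroying connectivity. *)

Set Implicit Arguments.
Unset Strict Implicit.
Unset Printing Implicit Defensive.
Import Order.TTheory GRing.Theory Num.Theory.

(** * Matroid intersection and base packing *)

(** The axioms of a matroid rank function; matroids enter only in this form, without a type of
    independent sets or bases. *)
Record rank_fun (T : finType) (r : {set T} -> nat) : Prop := RankFun {
  rk0 : r set0 = 0;
  rkS : forall A B : {set T}, A \subset B -> r A <= r B;
  rkU1 : forall x (A : {set T}), r (x |: A) <= (r A).+1;
  rkUI : forall A B : {set T}, r (A :|: B) + r (A :&: B) <= r A + r B
}.

Section RankFun.
Variable T : finType.
Implicit Types (r : {set T} -> nat) (A B S U I : {set T}).

Lemma rkU_card r A B : rank_fun r -> r (A :|: B) <= r A + #|B|.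
Proof.
move=> rr; have [n] := ubnP #|B|; elim: n B => // n IH B leB.
have [->|[x xB]] := set_0Vmem B; first by rewrite setU0 cards0 addn0.
move: leB; rewrite -{2}(setD1K xB) setUCA (cardsD1 x B) xB add1n => leB.
have := IH (B :\ x) leB; have := rkU1 rr x (A :|: B :\ x); lia.
Qed.

Lemma rk_le_card r A : rank_fun r -> r A <= #|A|.
Proof. by move=> rr; have := rkU_card set0 A rr; rewrite set0U rk0. Qed.

Lemma rk_loops r A : rank_fun r -> (forall x, x \in A -> r [set x] = 0) -> r A = 0.
Proof.
move=> rr; have [n] := ubnP #|A|; elim: n A => // n IH A leA A0.
have [->|[x xA]] := set_0Vmem A; first exact: rk0.
move: leA; rewrite (cardsD1 x) xA add1n => leA.
have := rkUI rr [set x] (A :\ x); rewrite setD1K // A0 // (IH (A :\ x)) //; first lia.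
by move=> y /setD1P [_ /A0].
Qed.

(** The rank function of the contraction of the non-loop [s], kept on the same type: [s] itself
    becomes a loop. *)
Lemma rank_fun_contract r s : rank_fun r -> r [set s] = 1 ->
  rank_fun (fun U => (r (s |: U)).-1).
Proof.
move=> rr r1.
have pos U : 0 < r (s |: U).
  by rewrite -r1; apply: rkS => //; rewrite subsetUl.
split=> [|A B sAB|x A|A B].
- by rewrite setU0 r1.
- by have := rkS rr (setUS [set s] sAB); lia.
- by rewrite setUCA; have := rkU1 rr x (s |: A); have := pos A; lia.
- have := rkUI rr (s |: A) (s |: B); rewrite -setUIr -setUUr.
  by have := pos A; have := pos B; have := pos (A :|: B); have := pos (A :&: B); lia.
Qed.

(* Schrijver's induction: if neither deleting nor contracting [s] works, the two
   violating sets contradict submodularity. *)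
Lemma matroid_intersection r1 r2 S k : rank_fun r1 -> rank_fun r2 ->
  (forall U, U \subset S -> k <= r1 U + r2 (S :\: U)) ->
  exists I, [/\ I \subset S, #|I| = k, r1 I = k & r2 I = k].
Proof.
have [n] := ubnP #|S|; elim: n S k r1 r2 => // n IH S k r1 r2 leS rr1 rr2 hk.
have [->|k0] := posnP k.
  by exists set0; rewrite sub0set cards0 !rk0.
have [s /and3P [sS /eqP r1s /eqP r2s]|noS] :=
  pickP (fun s => [&& s \in S, r1 [set s] == 1 & r2 [set s] == 1]); last first.
  (* With no common non-loop, every element of [S] that is not a loop of [r1] is a loop of [r2], so
     this choice of [U] forces [k = 0]. *)
  have := hk [set x in S | r1 [set x] == 0]; rewrite setIdE subsetIl => /(_ isT).
  rewrite -setIdE.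
  rewrite (rk_loops rr1) => [|x]; last by rewrite inE => /andP [_ /eqP].
  rewrite (rk_loops rr2) => [|x]; first lia.
  rewrite !inE => /andP [/nandP [/negP nS|n1] xS]; first by case: nS.
  move: (noS x).
  have := rk_le_card [set x] rr1; have := rk_le_card [set x] rr2.
  by rewrite cards1 xS /=; case: (r1 _) n1 => [|[|?]] //; case: (r2 _) => [|[|?]].
have cS : #|S| = (#|S :\ s|).+1 by rewrite (cardsD1 s) sS.
have [/forallP del|] := boolP [forall U : {set T}, (U \subset S :\ s) ==>
    (k <= r1 U + r2 (S :\ s :\: U))].
  have [|U sU|I [sI *]] := IH (S :\ s) k r1 r2 _ rr1 rr2; first lia.
    by have /implyP := del U; apply.
  by exists I; split=> //; apply: subset_trans sI (subsetDl _ _).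
rewrite negb_forall => /existsP [A]; rewrite negb_imply -ltnNge => /andP [sA ltA].
have rr1' := rank_fun_contract rr1 r1s; have rr2' := rank_fun_contract rr2 r2s.
have pos r U : rank_fun r -> r [set s] = 1 -> 0 < r (s |: U).
  by move=> rr <-; apply: rkS => //; rewrite subsetUl.
have [/forallP con|] := boolP [forall U : {set T}, (U \subset S :\ s) ==>
    (k.-1 <= (r1 (s |: U)).-1 + (r2 (s |: (S :\ s :\: U))).-1)].
  have [|U sU|I [sI cI r1I r2I]] := IH (S :\ s) k.-1 _ _ _ rr1' rr2'; first lia.
    by have /implyP := con U; apply.
  exists (s |: I); split.
  - by rewrite subUset sub1set sS (subset_trans sI) ?subsetDl.
  - rewrite cardsU1 cI; case: (boolP (s \in I)) => [/(subsetP sI)|_]; last lia.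
    by rewrite !inE eqxx.
  - by have := pos _ I rr1 r1s; lia.
  - by have := pos _ I rr2 r2s; lia.
rewrite negb_forall => /existsP [B]; rewrite negb_imply -ltnNge => /andP [sB ltB].
have sNA : s \notin A by apply/negP => /(subsetP sA); rewrite !inE eqxx.
have sNB : s \notin B by apply/negP => /(subsetP sB); rewrite !inE eqxx.
have p1 := pos _ B rr1 r1s; have p2 := pos _ (S :\ s :\: B) rr2 r2s.
(* The unions and intersections pair up to complements in [S], so [hU] and [hI] bound the sum of
   ranks below by [2 * k], while [ltA] and [ltB] leave at most [2 * k - 1]. *)
have := rkUI rr1 A (s |: B); have := rkUI rr2 (S :\ s :\: A) (s |: (S :\ s :\: B)).
have hU := hk (A :|: (s |: B)); have hI := hk (A :&: (s |: B)).
have sAS := subset_trans sA (subsetDl S [set s]).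
have sBS := subset_trans sB (subsetDl S [set s]).
have -> : (S :\ s :\: A) :|: (s |: (S :\ s :\: B)) = S :\: (A :&: (s |: B)).
  apply/setP => x; rewrite !inE; case: eqP => [->|]; rewrite ?sS ?(negbTE sNA) ?orbT //=.
  by case: (x \in A); case: (x \in B); case: (x \in S).
have -> : (S :\ s :\: A) :&: (s |: (S :\ s :\: B)) = S :\: (A :|: (s |: B)).
  apply/setP => x; rewrite !inE; case: eqP => [->|]; rewrite ?sS ?(negbTE sNA) ?orbT //=.
  by case: (x \in A); case: (x \in B); case: (x \in S).
move: hU hI; rewrite !subUset sAS sBS sub1set sS subIset ?sAS // => /(_ isT) hU /(_ isT) hI.
lia.
Qed.

End RankFun.

(* Matroid intersection of [t] disjoint copies of the matroid with the
   partition matroid forbidding an element to be used in two copies. *)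
Lemma matroid_packing (T : finType) (r : {set T} -> nat) (E : {set T}) (t : nat) : rank_fun r ->
  (forall F : {set T}, F \subset E -> t * r E <= #|E :\: F| + t * r F) ->
  exists I : 'I_t -> {set T},
    [/\ forall i, I i \subset E, forall i j, i != j -> [disjoint I i & I j]
      & forall i, r (I i) = r E].
Proof.
move=> rr hE.
pose sl (U : {set T * 'I_t}) (i : 'I_t) := [set e | (e, i) \in U].
pose r1 (U : {set T * 'I_t}) := \sum_(i < t) r (sl U i).
pose r2 (U : {set T * 'I_t}) := #|[set x.1 | x in U]|.
have slU (A B : {set T * 'I_t}) i : sl (A :|: B) i = sl A i :|: sl B i by apply/setP => e; rewrite !inE.
have slI (A B : {set T * 'I_t}) i : sl (A :&: B) i = sl A i :&: sl B i by apply/setP => e; rewrite !inE.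
have rr1 : rank_fun r1.
  split=> [|A B sAB|[x i] A|A B].
  - by rewrite /r1 big1 // => i _; rewrite -(rk0 rr); congr r; apply/setP => e; rewrite !inE.
  - apply: leq_sum => i _; apply: rkS => //; apply/subsetP => e; rewrite !inE.
    exact: (subsetP sAB).
  - rewrite /r1 (bigD1 i) //= [X in _ <= X.+1](bigD1 i) //= -addSn leq_add //.
      rewrite (_ : sl _ i = x |: sl A i) ?rkU1 //.
      by apply/setP => e; rewrite !inE xpair_eqE eqxx andbT.
    apply: leq_sum => j ji; rewrite (_ : sl _ j = sl A j) //.
    by apply/setP => e; rewrite !inE xpair_eqE (negbTE ji) andbF.
  - rewrite /r1 -!big_split /=; apply: leq_sum => i _; rewrite slU slI; exact: rkUI.
have rr2 : rank_fun r2.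
  split=> [|A B sAB|x A|A B].
  - by rewrite /r2 imset0 cards0.
  - by apply/subset_leq_card/imsetS.
  - by rewrite /r2 imsetU1 cardsU1; case: (_ \notin _).
  - rewrite /r2 imsetU -[leqRHS]cardsUI leq_add2l subset_leq_card //.
    by rewrite subsetI !imsetS ?subsetIl ?subsetIr.
have [U sU|I [sI cI r1I r2I]] := matroid_intersection (S := setX E [set: 'I_t]) (k := t * r E) rr1 rr2.
  (* [P] collects the elements with a copy outside [U], so all [t] copies of each element of
     [E :\: P] lie in [U]. *)
  set P := [set x.1 | x in setX E setT :\: U].
  have sPE : P \subset E.
    by apply/subsetP => e /imsetP [[e' i]]; rewrite !inE /= => /andP [_ /andP[eE _]] ->.
  have := hE (E :\: P) (subsetDl _ _).
  rewrite setDDr setDv set0U (setIidPr sPE) => /leq_trans; apply.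
  rewrite addnC leq_add2r /r1.
  rewrite -[t in t * _]card_ord -sum_nat_const; apply: leq_sum => i _.
  apply: rkS => //; apply/subsetP => e; rewrite !inE => /andP [eP eE].
  apply: contraR eP => eiU; apply/imsetP; exists (e, i) => //.
  by rewrite !inE eE eiU.
have sslE i : sl I i \subset E.
  by apply/subsetP => e; rewrite inE => /(subsetP sI); rewrite !inE andbT.
exists (sl I); split=> // [i j ij|i].
  rewrite -setI_eq0; apply/eqP/setP => e; rewrite !inE; apply/negP => /andP [ei ej].
  have /imset_injP inj : #|[set x.1 | x in I]| == #|I| by rewrite cI -r2I.
  by have := inj _ _ ei ej erefl; case=> /eqP; rewrite (negbTE ij).
apply/eqP; rewrite eqn_leq rkS //=.
(* The slice ranks add up to [t * r E] and none exceeds [r E], so the total deficiency is zero. *)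
have: \sum_j (r E - r (sl I j)) = 0.
  have : \sum_(j < t) (r E - r (sl I j)) + \sum_j r (sl I j) = t * r E.
    rewrite -big_split /= -[t in RHS]card_ord -sum_nat_const; apply: eq_bigr => j _.
    by rewrite subnK // rkS.
  by rewrite -/(r1 I) r1I => /eqP; rewrite -[X in _ == X]add0n eqn_add2r => /eqP.
by move/eqP; rewrite sum_nat_eq0 => /forallP /(_ i) /=; lia.
Qed.

(** * Generic realizations *)

Section Generic.
Import boolp classical_sets functions cardinality set_interval ereal lebesgue_measure.
Local Open Scope ring_scope.
Variable R : realType.

(** A countable set has Lebesgue measure zero, whereas the line has infinite measure. *)
Lemma exists_notin_countable (A : set R) : countable A -> exists y, ~ A y.
Proof.
move=> cA; apply: contrapT => nA.
have AT : A = setT by apply/seteqP; split=> y //= _; apply: contrapT => nAy; apply: nA; exists y.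
have := countable_lebesgue_measure0 cA; rewrite AT -set_itvNyy lebesgue_measure_itv /=.
by [].
Qed.

Lemma finite_set_roots (p : {poly R}) : p != 0 -> finite_set [set y | root p y]%classic.
Proof.
have [n] := ubnP (size p); elim: n p => // n IH p sp p0.
have [[a /factor_theorem [q pq]]|nroot] := pselect (exists a, root p a); last first.
  rewrite (_ : [set y | _]%classic = set0) //; apply/seteqP; split=> y //= ry.
  by apply: nroot; exists y.
have q0 : q != 0 by apply: contra_neq p0 => q0; rewrite pq q0 mul0r.
rewrite (_ : [set y | _]%classic = [set a] `|` [set y | root q y])%classic.
  rewrite finite_setU; split=> //; apply: IH => //.
  by move: sp; rewrite pq size_Mmonic ?monicXsubC // size_XsubC addn2.
apply/seteqP; split=> y /=; rewrite pq rootM root_XsubC.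
  by case/orP => [->|/eqP]; [right|left].
by case=> [->|->] //; rewrite eqxx orbT.
Qed.

Lemma countable_mpoly n (D : set (mpoly n rat)) : countable D.
Proof.
pose f (q : mpoly n rat) := pickle [seq (m, mcoeff m q) | m <- msupp q].
apply/countable_injP; exists f => p q _ _ /(pcan_inj pickleK) pq.
have spq : msupp p = msupp q.
  have E (r : mpoly n rat) : [seq x.1 | x <- [seq (m, mcoeff m r) | m <- msupp r]] = msupp r.
    by rewrite -map_comp -[RHS]map_id.
  by rewrite -E pq E.
apply/mpolyP => m; have [mp|mp] := boolP (m \in msupp p); last first.
  by rewrite !memN_msupp_eq0 // -?spq.
move: pq; rewrite -spq => /eq_in_map /(_ m mp) [].
by [].
Qed.

(** Induction on [n]: evaluating the first variables at [x] turns each nonzero polynomial into a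
    nonzero univariate one, and countably many finite root sets do not exhaust the reals, so a last
    coordinate can avoid them all. *)
Lemma alg_independent_exists n : exists x : 'I_n -> R, alg_independent x.
Proof.
elim: n => [|n [x xind]].
  exists (fun=> 0) => q; rewrite (nvar0_mpolyC q) mmapC => /eqP; rewrite fmorph_eq0 => /eqP ->.
  by rewrite mpolyC0.
pose P (q : mpoly n.+1 rat) := map_poly (mmap (@ratr R) x) (muni q).
have Pn0 q : q != 0 -> P q != 0.
  move=> q0; have [m0 m0q] : exists m, m \in msupp q.
    case E : (msupp q) => [|m ms]; first by rewrite -msupp_eq0 E in q0.
    by exists m; rewrite inE eqxx.
  pose res (m : multinom n.+1) := Multinom [tuple m (widen_ord (leqnSn n) i) | i < n].
  (* The coefficient of degree [m0 ord_max] is the value at [x] of a polynomial in which the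
     monomial [res m0] survives, since a monomial is determined by its last exponent and its
     restriction. *)
  apply/eqP => /polyP /(_ (m0 ord_max)); rewrite coef_map coef0 => /xind /(congr1 (mcoeff (res m0))).
  rewrite muniE coef_sum mcoeff0 raddf_sum /= (bigD1_seq m0) //= ?msupp_uniq //.
  rewrite !coefZ coefXn eqxx mulr1 mcoeffZ mcoeffX eqxx mulr1.
  rewrite big1 => [/eqP|m mm0]; first by rewrite addr0 mcoeff_eq0 m0q.
  rewrite coefZ coefXn; case: eqP => [e|_]; last by rewrite mulr0 mcoeff0.
  rewrite mulr1 mcoeffZ mcoeffX; case: eqP => [e'|_]; last by rewrite mulr0.
  case/eqP: mm0; apply/mnmP => i.
  have [j ->|->] := unliftP ord_max i; last by [].
  have /mnmP /(_ j) := e'; rewrite !mnmE.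
  by rewrite (_ : widen_ord _ j = lift ord_max j) //; apply: val_inj; rewrite /= /bump leqNgt ltn_ord.
have [y ny] : exists y, ~ (\bigcup_(q in [set q | q != 0]) [set y | root (P q) y])%classic y.
  apply: exists_notin_countable; apply: bigcup_countable; first exact: countable_mpoly.
  move=> q /= q0; apply: finite_set_countable.
  exact/finite_set_roots/Pn0.
pose x' (i : 'I_n.+1) := if unlift ord_max i is Some j then x j else y.
exists x' => q qx; apply: contrapT => /eqP q0; apply: ny; exists q => //=.
suff E : (P q).[y] = mmap (@ratr R) x' q by rewrite /root E qx.
rewrite /P muniE raddf_sum horner_sum /mmap; apply: eq_bigr => m _ /=.
rewrite map_polyZ /= map_polyXn hornerZ hornerXn mmapZ mmapX -mulrA; congr (_ * _).
rewrite /mmap1 big_ord_recr /= /x' unlift_none; congr (_ * _); apply: eq_bigr => i _.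
rewrite mnmE (_ : widen_ord _ i = lift ord_max i) ?liftK //.
by apply: val_inj; rewrite /= /bump leqNgt ltn_ord.
Qed.
End Generic.

(** * Row spaces as linear matroids *)

Section LinearAlgebra.
Local Open Scope ring_scope.

Lemma genmx_sum_rows (F : fieldType) (T : finType) (n : nat) (w : T -> 'rV[F]_n) (E : {set T}) :
  (\matrix_(i < #|E|) w (enum_val i) :=: \sum_(e in E) <<w e>>)%MS.
Proof.
apply/eqmxP/andP; split.
  apply/row_subP => i; rewrite rowK (sumsmx_sup (enum_val i)) ?enum_valP //.
  by rewrite genmxE.
apply/sumsmx_subP => e eE; rewrite genmxE -(enum_rankK_in eE eE) -(rowK (fun i => w (enum_val i))).
exact: row_sub.
Qed.

Lemma rank_fun_span (F : fieldType) (T : finType) (n : nat) (w : T -> 'rV[F]_n) :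
  rank_fun (fun E : {set T} => \rank (\sum_(e in E) <<w e>>)%MS).
Proof.
have sub (A B : {set T}) : A \subset B ->
    ((\sum_(e in A) <<w e>>) <= (\sum_(e in B) <<w e>>))%MS.
  move=> /subsetP sAB; apply/sumsmx_subP => e /sAB eB.
  by rewrite (sumsmx_sup e).
have subU (A B : {set T}) : ((\sum_(e in A :|: B) <<w e>>) <=
    (\sum_(e in A) <<w e>>) + (\sum_(e in B) <<w e>>))%MS.
  apply/sumsmx_subP => e; rewrite inE => /orP [eA|eB].
    by apply: submx_trans (addsmxSl _ _); rewrite (sumsmx_sup e).
  by apply: submx_trans (addsmxSr _ _); rewrite (sumsmx_sup e).
split=> [|A B sAB|x A|A B].
- by rewrite big_set0 mxrank0.
- exact/mxrankS/sub.
- have := mxrankS (subU [set x] A); rewrite big_set1.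
  move/leq_trans; apply; apply: leq_trans (mxrank_adds_leqif _ _) _.
  by rewrite -[leqRHS]add1n leq_add2r mxrank_gen rank_leq_row.
- rewrite -[leqRHS]mxrank_sum_cap leq_add //; first exact: mxrankS (subU A B).
  by apply: mxrankS; rewrite sub_capmx !sub // ?subsetIl ?subsetIr.
Qed.

(** Rank-nullity for [P] on the sum: the kernel contains [U] and the image contains that of [S]. *)
Lemma mxrank_adds_ker (F : fieldType) (m1 m2 n k : nat) (U : 'M[F]_(m1, n))
    (S : 'M_(m2, n)) (P : 'M_(n, k)) :
  U *m P = 0 -> (\rank U + \rank (S *m P)%R <= \rank (U + S))%N.
Proof.
move=> UP; rewrite -(mxrank_mul_ker (U + S)%MS P) addnC leq_add // mxrankS //.
  by rewrite submxMr // addsmxSr.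
by rewrite sub_capmx addsmxSl; apply/sub_kermxP.
Qed.
End LinearAlgebra.

Section Specialization.
Local Open Scope ring_scope.
Variables (R : realType) (d : nat) (V : finType).
Local Notation N := #|{: V * 'I_d}|.
Implicit Types (p q : V -> 'rV[R]_d).

Definition coords p (c : 'I_N) : R := p (enum_val c).1 0 (enum_val c).2.
Definition eval_at p : mpoly N rat -> R := mmap (@ratr R) (coords p).
HB.instance Definition _ p := GRing.RMorphism.on (eval_at p).

Lemma eval_atX p v i : eval_at p (mpolyX _ (mnm1 (enum_rank (v, i)))) = p v 0 i.
Proof. by rewrite /eval_at mmapX mmap1U /coords enum_rankK. Qed.

Lemma generic_realizationP : generic (@generic_realization R d V).
Proof.
rewrite /generic_realization; case: classical_sets.xgetP => [p _ //|np]; exfalso.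
have [x xind] := alg_independent_exists R N.
apply: (np (fun v => \row_i x (enum_rank (v, i)))).
move=> q qx; apply: xind; rewrite -qx; congr (mmap _ _ _); apply/boolp.funext => c.
by rewrite mxE -surjective_pairing enum_valK.
Qed.

(** A nonvanishing minor of maximal size at [q] comes from a nonzero polynomial in the coordinates,
    which cannot vanish at the generic [p]. *)
Lemma generic_rank_max p q m n (A : 'M[mpoly N rat]_(m, n)) : generic p ->
  (\rank (map_mx (eval_at q) A) <= \rank (map_mx (eval_at p) A))%N.
Proof.
move=> gp; set B := map_mx _ A; set f := maxrankfun B.
have fullB : row_full (rowsub f B)^T.
  by rewrite /row_full mxrank_tr; exact: maxrowsub_free.
set g := fullrankfun fullB.
have := fullrowsub_unit fullB; rewrite -/g unitmxE unitfE => detB.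
pose A' := mxsub g id (mxsub f id A)^T.
have EB : rowsub g (rowsub f B)^T = map_mx (eval_at q) A'.
  by rewrite /A' map_mxsub -map_trmx map_mxsub.
have detA : \det (map_mx (eval_at p) A') != 0.
  rewrite det_map_mx; apply: contra_neq detB => /gp detA0.
  by rewrite EB det_map_mx detA0 rmorph0.
have : map_mx (eval_at p) A' \in unitmx by rewrite unitmxE unitfE.
rewrite -row_full_unit /row_full => /eqP rA.
rewrite -[X in (X <= _)%N]rA /A' map_mxsub -map_trmx map_mxsub.
rewrite (leq_trans (mxrankS (rowsub_sub _ _))) // !mxrank_tr.
exact: mxrankS (rowsub_sub _ _).
Qed.

Lemma generic_row_free p v (B : {set V}) : generic p -> v \notin B -> (#|B| <= d)%N ->
  row_free (\matrix_(i < #|B|) (p v - p (enum_val i))).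
Proof.
move=> gp vB cB.
pose X u j : mpoly N rat := mpolyX _ (mnm1 (enum_rank (u, j))).
pose A := \matrix_(i < #|B|, j < d) (X v j - X (enum_val i) j).
have E q : map_mx (eval_at q) A = \matrix_(i < #|B|) (q v - q (enum_val i)).
  by apply/matrixP => i j; rewrite !mxE rmorphB /= !eval_atX.
(* Special position: [v] at the origin and [B] at the negatives of distinct unit vectors, so the
   differences are rows of the identity. *)
pose q u : 'rV[R]_d := if u \in B then - \row_j (index u (enum B) == j)%:R else 0.
rewrite /row_free eqn_leq rank_leq_row -E (leq_trans _ (generic_rank_max q A gp)) //.
rewrite (_ : map_mx _ A = pid_mx #|B|) ?rank_pid_mx //.
rewrite E; apply/matrixP => i j; rewrite !mxE /q (negbTE vB) enum_valP !mxE add0r opprK.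
rewrite ltn_ord andbT; congr (_ == _)%:R.
by rewrite /enum_val index_uniq ?enum_uniq // -cardE.
Qed.
End Specialization.

(** * Rigidity matrices and extensions *)

Lemma subset_of_card (T : finType) (A : {set T}) k : k <= #|A| ->
  exists B : {set T}, B \subset A /\ #|B| = k.
Proof.
move=> kA; exists [set x in take k (enum A)]; split.
  by apply/subsetP => x; rewrite inE => /mem_take; rewrite mem_enum.
rewrite cardsE; have /card_uniqP -> : uniq (take k (enum A)) by rewrite take_uniq ?enum_uniq.
by rewrite size_takel // -cardE.
Qed.

Lemma eq_set2 (T : finType) (a b x y : T) :
  [set a; b] = [set x; y] -> (a = x /\ b = y) \/ (a = y /\ b = x).
Proof.
move=> E.
have : a \in [set x; y] by rewrite -E set21.
have : b \in [set x; y] by rewrite -E set22.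
have : x \in [set a; b] by rewrite E set21.
have : y \in [set a; b] by rewrite E set22.
rewrite !inE; do 4!case/orP => /eqP ?; subst; first [by left | by right].
Qed.

Definition star (V : finType) (v : V) (B : {set V}) : {set {set V}} :=
  [set [set v; b] | b in B].

Lemma mem_star (V : finType) (v b : V) (B : {set V}) : b \in B -> [set v; b] \in star v B.
Proof. by move=> bB; apply/imsetP; exists b. Qed.

Section Rows.
Local Open Scope ring_scope.
Variables (R : realType) (d : nat) (V : finType).
Local Notation N := #|{: V * 'I_d}|.
Implicit Types (p q : V -> 'rV[R]_d) (e : {set V}) (E F : {set {set V}}).

(** The embedding of a [d]-vector into the columns of [v]; right multiplication by the transpose
    extracts these columns from a row. *)
Definition vblock (v : V) : 'M[R]_(d, N) := \matrix_(i, c) (enum_rank (v, i) == c)%:R.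

Lemma mul_vblock (x : 'rV[R]_d) v u i :
  (x *m vblock v) 0 (enum_rank (u, i)) = if v == u then x 0 i else 0.
Proof.
rewrite mxE; case: eqP => [->|nvu].
  rewrite (bigD1 i) //= mxE eqxx mulr1 big1 ?addr0 // => j ji.
  by rewrite mxE (inj_eq enum_rank_inj) xpair_eqE (negbTE ji) andbF mulr0.
rewrite big1 // => j _; rewrite mxE (inj_eq enum_rank_inj) xpair_eqE.
by case: eqP nvu => // _ _; rewrite mulr0.
Qed.

(** Indexed by the edge itself rather than by its position in an enumeration, so that rows for
    different edge sets can be compared. *)
Definition erow p e : 'rV[R]_N :=
  \row_c let: (w, i) := enum_val c in
    if w \in e then \sum_(v in e) (p w 0 i - p v 0 i) else 0.

Lemma erow_vblock p e v :
  erow p e *m (vblock v)^T = if v \in e then \sum_(u in e) (p v - p u) else 0.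
Proof.
apply/rowP => i; rewrite mxE (bigD1 (enum_rank (v, i))) //= !mxE eqxx mulr1 enum_rankK.
rewrite [X in _ + X]big1 ?addr0 => [|c ci]; last by rewrite !mxE eq_sym (negbTE ci) mulr0.
by case: ifP => _; rewrite ?mxE // summxE; apply: eq_bigr => u _; rewrite !mxE.
Qed.

Lemma erow2 p a b :
  erow p [set a; b] = (p a - p b) *m vblock a + (p b - p a) *m vblock b.
Proof.
apply/rowP => c; rewrite [RHS]mxE -(enum_valK c); case: (enum_val c) => w i {c}.
rewrite !mul_vblock mxE enum_rankK !inE (eq_sym a) (eq_sym b).
have [ab|ab] := eqVneq a b.
  rewrite {}ab setUid big_set1 orbb; case: eqP => [->|_]; rewrite ?subrr ?mxE ?addr0 //.
rewrite big_setU1 ?inE // big_set1.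
have [->|wa] := eqVneq w a; first by rewrite (negbTE ab) /= subrr add0r addr0 !mxE.
by rewrite /=; case: eqP => [->|_]; rewrite ?subrr ?addr0 ?add0r // !mxE.
Qed.

Lemma eq_erow p q e : {in e, p =1 q} -> erow p e = erow q e.
Proof.
move=> pq; apply/rowP => c; rewrite !mxE; case: (enum_val c) => w i.
by case: ifP => // we; apply: eq_bigr => v ve; rewrite !pq.
Qed.

Definition espan p E : 'M[R]_N := (\sum_(e in E) <<erow p e>>)%MS.

Lemma erow_espan p e E : e \in E -> (erow p e <= espan p E)%MS.
Proof. by move=> eE; rewrite /espan (sumsmx_sup e) // genmxE. Qed.

Lemma espan_subP p E m (A : 'M_(m, N)) :
  reflect (forall e, e \in E -> (erow p e <= A)%MS) (espan p E <= A)%MS.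
Proof.
by apply: (iffP sumsmx_subP) => h e eE; have := h e eE; rewrite genmxE.
Qed.

Lemma espanS p E F : E \subset F -> (espan p E <= espan p F)%MS.
Proof. by move=> /subsetP sEF; apply/espan_subP => e /sEF; exact: erow_espan. Qed.

Lemma mxrank_rigidity_mx E p : \rank (rigidity_mx E p) = \rank (espan p E).
Proof.
rewrite /espan -(genmx_sum_rows (erow p)); congr (\rank _); apply/matrixP => r c.
by rewrite !mxE.
Qed.

Lemma generic_rankE E : generic_rank R d E = \rank (espan (@generic_realization R d V) E).
Proof. exact: mxrank_rigidity_mx. Qed.

Lemma rank_fun_generic : rank_fun (@generic_rank R d V).
Proof.
have rf := rank_fun_span (erow (@generic_realization R d V)).
split=> *; rewrite !generic_rankE; first exact: (rk0 rf).
- exact: (rkS rf).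
- exact: (rkU1 rf).
- exact: (rkUI rf).
Qed.

Lemma rank_espan_generic q E : (\rank (espan q E) <= generic_rank R d E)%N.
Proof.
rewrite generic_rankE -!mxrank_rigidity_mx.
pose A : 'M[mpoly N rat]_(#|E|, N) := \matrix_(r < #|E|, c < N)
    let e : {set V} := enum_val r in
    let: (w, i) := enum_val c in
    if w \in e then \sum_(v in e) (mpolyX _ (mnm1 (enum_rank (w, i))) -
       mpolyX _ (mnm1 (enum_rank (v, i)))) else 0.
have EA p : rigidity_mx E p = map_mx (eval_at p) A.
  apply/matrixP => r c; rewrite !mxE; case: (enum_val c) => w i /=.
  case: ifP => _; last by rewrite rmorph0.
  by rewrite rmorph_sum; apply: eq_bigr => v _; rewrite rmorphB /= !eval_atX.
by rewrite !EA; apply/generic_rank_max/generic_realizationP.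
Qed.
End Rows.

Section Extensions.
Local Open Scope ring_scope.
Variables (R : realType) (d : nat) (V : finType).
Local Notation N := #|{: V * 'I_d}|.
Local Notation p := (@generic_realization R d V).
Local Notation r := (@generic_rank R d V).
Implicit Types (v x y : V) (A B : {set V}) (F : {set {set V}}).

Lemma espan_vblock0 (q : V -> 'rV[R]_d) F v : (forall e, e \in F -> v \notin e) ->
  espan q F *m (vblock R d v)^T = 0.
Proof.
move=> vF; apply/eqP; rewrite -sub_kermx; apply/espan_subP => e eF.
by rewrite sub_kermx erow_vblock (negbTE (vF e eF)).
Qed.

(** The rows of [F] vanish in the columns of [v], where the new rows are the independent vectors
    [p v - p b]. *)
Lemma generic_rank_extend0 F v B : (forall e, e \in F -> v \notin e) ->
  v \notin B -> (#|B| <= d)%N -> (r F + #|B| <= r (F :|: star v B))%N.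
Proof.
move=> vF vB cB; have := generic_row_free (@generic_realizationP R d V) vB cB.
set M := \matrix_i _ => /eqP rM.
rewrite !generic_rankE -[X in (_ + X)%N]rM.
have sM : (M <= espan p (star v B) *m (vblock R d v)^T)%MS.
  apply/row_subP => i; rewrite rowK; set b := enum_val i.
  have bB : b \in B by exact: enum_valP.
  have vb : v != b by apply: contraNneq vB => ->.
  have -> : p v - p b = erow p [set v; b] *m (vblock R d v)^T.
    by rewrite erow_vblock set21 big_setU1 ?inE // big_set1 /= subrr add0r.
  by rewrite submxMr // erow_espan // mem_star.
have := mxrank_adds_ker (espan p (star v B)) (espan_vblock0 p vF).
move/(leq_trans (leq_add (leqnn _) (mxrankS sM)))/leq_trans; apply.
by apply: mxrankS; rewrite addsmx_sub !espanS ?subsetUl ?subsetUr.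
Qed.

(* Placing [v] at the midpoint of [x y] makes the rows of [vx] and [vy] sum to
   half of the row of [xy]. *)
Lemma generic_rank_extend1 F v x y A : (forall e, e \in F -> v \notin e) ->
  x != y -> x \in A -> y \in A -> v \notin A -> (d < #|A|)%N -> (0 < d)%N ->
  (r ([set x; y] |: F) + d <= r (F :|: star v A))%N.
Proof.
move=> vF xy xA yA vA cA d0.
have vx : v != x by apply: contraNneq vA => ->.
have vy : v != y by apply: contraNneq vA => ->.
(* Together with [x] and [y] these give the [d + 1] edges at [v] of a 1-extension. *)
have [Z [sZ cZ]] : exists Z : {set V}, Z \subset A :\ x :\ y /\ #|Z| = d.-1.
  apply: subset_of_card; move: cA; rewrite (cardsD1 x) xA (cardsD1 y) in_setD1 eq_sym xy yA.
  by lia.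
have xZ : x \notin Z by apply/negP => /(subsetP sZ); rewrite !inE eqxx andbF.
have yZ : y \notin Z by apply/negP => /(subsetP sZ); rewrite !inE eqxx.
have ZA z : z \in Z -> z \in A by move=> /(subsetP sZ); rewrite !inE => /and3P [].
have vZ : v \notin Z by apply: contra vA => /ZA.
have cB : #|y |: Z| = d by rewrite cardsU1 yZ cZ add1n prednK.
have xB : x \notin y |: Z by rewrite !inE negb_or xy.
have lB : (#|y |: Z| <= d)%N by rewrite cB.
have := generic_row_free (@generic_realizationP R d V) xB lB.
set M := \matrix_i _ => rM.
pose q u := if u == v then 2%:R^-1 *: (p x + p y) else p u.
have qv : q v = 2%:R^-1 *: (p x + p y) by rewrite /q eqxx.
have qE u : u != v -> q u = p u by rewrite /q => /negbTE ->.
pose S := espan q (star v (x |: Z)).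
have vxyF e : e \in [set x; y] |: F -> v \notin e.
  by case/setU1P => [->|/vF //]; rewrite !inE negb_or vx vy.
have qp (e : {set V}) : v \notin e -> erow q e = erow p e.
  by move=> ve; apply: eq_erow => u ue; apply: qE; apply: contraNneq ve => <-.
have qvz z : z \in x |: Z -> erow q [set v; z] *m (vblock R d v)^T = q v - p z.
  move=> zxZ; have vz : v != z.
    by apply: contraTneq zxZ => <-; rewrite !inE negb_or vx.
  by rewrite erow_vblock set21 big_setU1 ?inE // big_set1 /= subrr add0r (qE z) // eq_sym.
have sS z : z \in x |: Z -> (q v - p z <= S *m (vblock R d v)^T)%MS.
  by move=> zZ; rewrite -qvz // submxMr // erow_espan // mem_star.
(* In the columns of [v], the row of [vx] is a multiple of [p x - p y]; differences with the other
   rows give each [p x - p b], so the rank there is [d]. *)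
have sM : (M <= S *m (vblock R d v)^T)%MS.
  apply/row_subP => i; rewrite rowK; set b := enum_val i.
  have /setU1P [->|bZ] : b \in y |: Z by exact: enum_valP.
    have -> : p x - p y = (- 2%:R) *: (q v - p x).
      by apply/rowP => j; rewrite qv !mxE; field.
    by rewrite scalemx_sub // sS // setU11.
  have -> : p x - p b = (q v - p b) - (q v - p x).
    by apply/rowP => j; rewrite !mxE; ring.
  by rewrite addmx_sub ?eqmx_opp ?sS ?setU11 // setU1r.
(* A bound at the special position [q] suffices, since the generic rank is at least as large. *)
apply: leq_trans (rank_espan_generic q _).
have := mxrank_adds_ker S (espan_vblock0 p vxyF).
have rM' : \rank M = d by rewrite (eqP rM) cB.
move/(leq_trans (leq_add (leqnn _) (mxrankS sM))).
rewrite rM' -generic_rankE => /leq_trans; apply; apply: mxrankS.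
rewrite addsmx_sub; apply/andP; split; last first.
  rewrite espanS // subsetU // /star imsetS ?orbT //.
  by apply/subsetP => z /setU1P [->|/ZA].
apply/espan_subP => e /setU1P [->|eF]; last first.
  by rewrite -qp ?vF // erow_espan // inE eF.
have -> : erow p [set x; y] = 2%:R *: (erow q [set v; x] + erow q [set v; y]).
  rewrite !erow2 qv !(qE x, qE y) 1?eq_sym //.
  have -> : 2%:R^-1 *: (p x + p y) - p x = 2%:R^-1 *: (p y - p x).
    by apply/rowP => j; rewrite !mxE; field.
  have -> : 2%:R^-1 *: (p x + p y) - p y = - (2%:R^-1 *: (p y - p x)).
    by apply/rowP => j; rewrite !mxE; field.
  have -> : p x - 2%:R^-1 *: (p x + p y) = 2%:R^-1 *: (p x - p y).
    by apply/rowP => j; rewrite !mxE; field.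
  have -> : p y - 2%:R^-1 *: (p x + p y) = 2%:R^-1 *: (p y - p x).
    by apply/rowP => j; rewrite !mxE; field.
  rewrite mulNmx addrACA subrr add0r -!scalemxAl -scalerDr scalerA mulfV ?scale1r //.
  by rewrite pnatr_eq0.
by rewrite scalemx_sub // addmx_sub // erow_espan // inE mem_star ?orbT.
Qed.

(** With [v] as base point, eliminating [l v] turns the affine dependence into a linear one between
    the independent differences [p v - p a]. *)
Lemma generic_affine_independent A (l : V -> R) : (#|A| <= d.+1)%N ->
  \sum_(a in A) l a = 0 -> \sum_(a in A) l a *: p a = 0 -> {in A, l =1 fun=> 0}.
Proof.
move=> cA l0 lp0 v vA /=.
have vAv : v \notin A :\ v by rewrite !inE eqxx.
have cAv : (#|A :\ v| <= d)%N by move: cA; rewrite (cardsD1 v) vA.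
have /row_free_inj inj := generic_row_free (@generic_realizationP R d V) vAv cAv.
have l0' : l v = - \sum_(a in A :\ v) l a.
  by apply/eqP; rewrite -addr_eq0 -(big_setD1 v vA) l0.
have z : forall a, a \in A :\ v -> l a = 0.
  pose u : 'rV[R]_#|A :\ v| := \row_i l (enum_val i).
  have u0 : u = 0.
    apply: inj; rewrite mul0mx mulmx_sum_row.
    under eq_bigr do rewrite mxE rowK.
    rewrite -(big_enum_val (fun a => l a *: (p v - p a))) /=.
    under eq_bigr do rewrite scalerBr.
    rewrite sumrB -scaler_suml.
    move: lp0; rewrite (big_setD1 v vA) /= l0' scaleNr => /eqP.
    by rewrite addrC subr_eq0 => /eqP ->; rewrite subrr.
  move=> a aA; move/rowP/(_ (enum_rank_in aA a)): u0.
  by rewrite !mxE enum_rankK_in.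
by rewrite l0' big1 ?oppr0.
Qed.

(* An affine dependence [l] of the [d + 2] points of [A] makes
   [l a * l b] a self-stress of the complete graph on [A]. *)
Lemma generic_rank_clique F A x y : #|A| = d.+2 -> x \in A -> y \in A -> x != y ->
  (forall a b, a \in A -> b \in A -> a != b -> [set a; b] != [set x; y] -> [set a; b] \in F) ->
  r ([set x; y] |: F) = r F.
Proof.
move=> cA xA yA xy hF; apply/eqP; rewrite eqn_leq.
rewrite [X in _ && X](rkS (@rank_fun_generic R d V)) ?subsetUr // andbT.
rewrite !generic_rankE; apply: mxrankS; apply/espan_subP => e /setU1P [->{e}|]; last first.
  exact: erow_espan.
have [l [l0 lp0 [c cA' lc]]] : exists l : V -> R, [/\ \sum_(a in A) l a = 0,
    \sum_(a in A) l a *: p a = 0 & exists2 c, c \in A & l c != 0].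
  pose P : 'M[R]_(#|A|, d) := \matrix_i p (enum_val i).
  (* Affine dependences are left-kernel vectors of the points extended by a coordinate 1; there are
     [d + 2] rows but only [d + 1] columns. *)
  pose M : 'M[R]_(#|A|, 1 + d) := row_mx (const_mx 1) P.
  have : ~~ row_free M.
    by rewrite /row_free neq_ltn (leq_ltn_trans (rank_leq_col M)) // add1n cA.
  rewrite -kermx_eq0 => /rowV0Pn [u /sub_kermxP uM u0].
  exists (fun a => u 0 (enum_rank_in xA a)).
  have sumA (W : lmodType R) (f : V -> W) :
      \sum_(a in A) u 0 (enum_rank_in xA a) *: f a = \sum_i u 0 i *: f (enum_val i).
    by rewrite big_enum_val; apply: eq_bigr => i _; rewrite enum_valK_in.
  move: uM; rewrite /M mul_mx_row -[RHS](row_mx0 _ 1 1 d) => /eq_row_mx [u1 uP]; split.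
  - have := sumA R^o (fun=> 1); rewrite /GRing.scale /=.
    under eq_bigr do rewrite mulr1.
    move=> ->; transitivity ((u *m const_mx 1 : 'rV_1) 0 0); last by rewrite u1 mxE.
    by rewrite mxE; apply: eq_bigr => i _; rewrite mxE.
  - rewrite sumA -[RHS]uP mulmx_sum_row; apply: eq_bigr => i _; by rewrite rowK.
  - have /rV0Pn [i ui] := u0; exists (enum_val i); first exact: enum_valP.
    by rewrite enum_valK_in.
(* A zero coefficient would leave a nontrivial dependence among [d + 1] generic points. *)
have ln0 a : a \in A -> l a != 0.
  move=> aA; apply: contra_neq lc => la.
  have [->//|ca] := eqVneq c a.
  apply: (@generic_affine_independent (A :\ a) l); rewrite ?inE ?ca //.
  - by move: cA; rewrite (cardsD1 a) aA add1n => -[->].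
  - by rewrite -[RHS]l0 [RHS](big_setD1 a) //= la add0r.
  - by rewrite -[RHS]lp0 [RHS](big_setD1 a) //= la scale0r add0r.
have stress : \sum_(a in A) \sum_(b in A) (l a * l b) *: erow p [set a; b] = 0.
  have half : \sum_(a in A) \sum_(b in A) (l a * l b) *: ((p a - p b) *m vblock R d a) = 0.
    rewrite big1 // => a aA.
    under eq_bigr => b _ do rewrite -scalerA scalemxAl.
    rewrite -scaler_sumr -mulmx_suml.
    under eq_bigr => b _ do rewrite scalerBr.
    by rewrite sumrB lp0 -scaler_suml l0 scale0r subrr mul0mx scaler0.
  under eq_bigr => a _ do under eq_bigr => b _ do rewrite erow2 scalerDr.
  under eq_bigr => a _ do rewrite big_split.
  rewrite big_split /= half add0r exchange_big /= -[RHS]half.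
  by do 2!(apply: eq_bigr => ? _); rewrite mulrC.
(* The stress is a sum over ordered pairs: the row of [xy] occurs twice, diagonal terms vanish, and
   all other terms lie in the span of [F]. *)
pose G a b := (l a * l b) *: erow p [set a; b].
have memF a b : a \in A -> b \in A -> [set a; b] != [set x; y] -> (G a b <= espan p F)%MS.
  move=> aA bA nab; rewrite /G scalemx_sub //.
  have [<-|ab] := eqVneq a b; first by rewrite erow2 subrr mul0mx addr0 sub0mx.
  by rewrite erow_espan ?hF.
move: stress; rewrite -[\sum_(a in A) _]/(\sum_(a in A) \sum_(b in A) G a b).
rewrite pair_big /= (bigD1 (x, y)) /= ?xA // (bigD1 (y, x)) /=; last first.
  by rewrite yA xA xpair_eqE eq_sym (negbTE xy).
have -> : G y x = G x y by rewrite /G mulrC setUC.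
rewrite addrA => /eqP; rewrite addr_eq0 => /eqP E.
have GF : ((G x y + G x y)%R <= espan p F)%MS.
  rewrite E eqmx_opp summx_sub // => -[a b] /= /andP [/andP [/andP [aA bA] n1] n2].
  apply: memF => //; apply: contraNneq n2 => /eq_set2 [] [ax b_y].
    by move: n1; rewrite ax b_y eqxx.
  by rewrite ax b_y.
have -> : erow p [set x; y] = ((l x * l y)^-1 / 2%:R) *: (G x y + G x y).
  rewrite -mulr2n -scaler_nat scalerA /G scalerA [X in X *: _](_ : _ = 1) ?scale1r //.
  by field; rewrite !ln0.
exact: scalemx_sub.
Qed.
End Extensions.

(** * Averaging over vertex orders *)

Section Averaging.
Local Open Scope ring_scope.
Variables (V : finType) (d : nat) (nb : V -> {set V}) (clq : pred {set V}).
Hypothesis d_gt0 : (0 < d)%N.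
Implicit Types (M W : {set V}) (u v : V).

(* A lower bound for the rank increase when a vertex arrives with earlier
   neighbours [M]. *)
Definition gain M : nat :=
  if (#|M| <= d)%N || clq M then minn d #|M| else d.+1.

(* The average of [min(d, i)] over [0 <= i <= m], that is the expected gain of a
   vertex of degree [m] whose neighbourhood is a clique. *)
Definition share0 (m : nat) : rat :=
  if (m < d)%N then m%:R / 2%:R else d%:R - (d * d.+1)%:R / (2 * m.+1)%:R.

(* The expected gain in the worst case of a non-clique neighbourhood, a clique
   plus one vertex: an [i]-subset is then a non-clique with probability [i / m]. *)
Definition share1 (m : nat) : rat := d%:R + 2%:R^-1 - (d * d.+1)%:R / (2 * m)%:R.

(** The threshold is [< d] here but [<= d] in [gain]; at [#|M| = d] the two formulas agree by
    [share1_d]. *)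
Definition share M : rat :=
  if (#|M| < d)%N || clq M then share0 #|M| else share1 #|M|.

(** [m.+1%:R * share0 m] is the sum of [min(d, i)] over [i <= m], so one step adds one term. *)
Lemma share0_rec m : m.+2%:R * share0 m.+1 = (minn d m.+1)%:R + m.+1%:R * share0 m.
Proof.
have m0 : (m%:R : rat) >= 0 by exact: ler0n.
rewrite /share0; have [md|dm] := ltnP m.+1 d.
  by rewrite (ltnW md) -!natr1; field.
have [md|dm'] := ltnP m d.
  have -> : d = m.+1 by lia.
  by rewrite !natrM -!natr1; field; lra.
by rewrite !natrM -!natr1; field; lra.
Qed.

(** Condition on the last among the vertex and its [m + 1] neighbours: the vertex itself gains
    [d + 1], one neighbour leaves a clique, and the other [m] leave a clique plus one vertex. *)
Lemma share1_rec m : (d <= m)%N ->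
  m.+2%:R * share1 m.+1 = d.+1%:R + m%:R * share1 m + share0 m.
Proof.
move=> dm; have m0 : (m%:R : rat) > 0 by rewrite ltr0n; lia.
rewrite /share0 /share1 ltnNge dm /= !natrM -!natr1; field; lra.
Qed.

Lemma share1_d : share1 d = share0 d.
Proof.
have d0 : (d%:R : rat) > 0 by rewrite ltr0n.
by rewrite /share0 /share1 ltnn !natrM -!natr1; field; lra.
Qed.

Lemma share0_le1 m : (d <= m)%N -> share0 m <= share1 m.
Proof.
move=> dm; have d0 : (d%:R : rat) > 0 by rewrite ltr0n.
have dmR : (d%:R : rat) <= m%:R by rewrite ler_nat.
rewrite -subr_ge0 /share0 /share1 ltnNge dm /=.
have -> : d%:R + 2%:R^-1 - (d * d.+1)%:R / (2 * m)%:R - (d%:R - (d * d.+1)%:R / (2 * m.+1)%:R)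
   = (m%:R * (m%:R + 1) - d%:R * (d%:R + 1)) / (2%:R * m%:R * (m%:R + 1)) :> rat.
  by rewrite !natrM -!natr1; field; lra.
by apply: divr_ge0; nra.
Qed.

Hypothesis clq_sub : forall M M', M' \subset M -> clq M -> clq M'.
Hypothesis clq_glue : forall v M u u', M \subset nb v -> (d < #|M|)%N ->
  u \in M -> u' \in M -> u != u' -> clq (M :\ u) -> clq (M :\ u') -> clq M.

(* At most one [M :\ u] is a clique when [M] is not, by [clq_glue]. *)
Lemma share_step v M : M \subset nb v ->
  #|M|.+1%:R * share M <= (gain M)%:R + \sum_(u in M) share (M :\ u).
Proof.
move=> sM; have cD u : u \in M -> #|M| = #|M :\ u|.+1 by move=> uM; rewrite (cardsD1 u) uM.
have [m0|] := posnP #|M|.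
  rewrite /share /gain m0 d_gt0 leq0n minn0 /= /share0 d_gt0 mul0r mulr0 big1 //.
  by move=> u; rewrite (cards0_eq m0) inE.
case mE : #|M| => [//|m] _; rewrite -mE.
have cD' u : u \in M -> #|M :\ u| = m by move=> /cD; rewrite mE => -[].
have [cM|ncM] := boolP (clq M).
  rewrite /gain /share cM !orbT mE share0_rec lerD2l.
  rewrite (eq_bigr (fun=> share0 m)) ?sumr_const ?mE ?mulr_natl // => u uM.
  by rewrite (clq_sub (subsetDl M [set u]) cM) orbT cD'.
have [md|dm] := leqP m.+1 d.
  rewrite /gain /share mE md (negbTE ncM) orbF /= (_ : (if _ then _ else _) = share0 m.+1).
    rewrite share0_rec lerD2l (eq_bigr (fun=> share0 m)) ?sumr_const ?mE ?mulr_natl // => u uM.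
    by rewrite cD' // md.
  case: ltnP => // dm; have -> : m.+1 = d by lia.
  by rewrite share1_d.
rewrite /gain {1}/share mE (negbTE ncM) !orbF (leqNgt m.+1 d) dm /= ltnNge (ltnW dm) /= share1_rec; last by lia.
have le1 u : u \in M -> share0 m <= share (M :\ u).
  move=> uM; rewrite /share cD' //; case: ifP => // _; apply: share0_le1; lia.
have share1E u : u \in M -> ~~ clq (M :\ u) -> share (M :\ u) = share1 m.
  by move=> uM nc; rewrite /share cD' // (negbTE nc) orbF ltnNge (ltnSE dm).
rewrite -addrA lerD2l.
have [w wM hw] : exists2 w, w \in M & forall u, u \in M -> u != w -> ~~ clq (M :\ u).
  have [w /andP [wM cw]|none] := pickP [pred w | (w \in M) && clq (M :\ w)].
    exists w => // u uM uw; apply: contra ncM => cu.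
    by apply: (clq_glue sM _ uM wM uw) => //; rewrite mE.
  have /card_gt0P [w wM] : (0 < #|M|)%N by rewrite mE.
  by exists w => // u uM _; have := none u; rewrite /= uM /= => ->.
rewrite (big_setD1 w wM) /= addrC lerD ?le1 //.
rewrite (eq_bigr (fun=> share1 m)) ?sumr_const ?cD' ?mulr_natl // => u.
by rewrite !inE => /andP [uw uM]; rewrite share1E ?hw.
Qed.

Hypothesis nb_irr : forall v, v \notin nb v.
Variable rho : {set V} -> nat.
Hypothesis rho_del : forall W u, u \in W -> (rho (W :\ u) + gain (nb u :&: W) <= rho W)%N.

(* Instead of averaging over vertex orders, average over the last vertex and
   recurse. *)
Lemma sum_share_le W : \sum_(v in W) share (nb v :&: W) <= (rho W)%:R.
Proof.
have [n] := ubnP #|W|; elim: n W => // n IH W leW.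
have [->|[w wW]] := set_0Vmem W; first by rewrite big_set0 ler0n.
have W0 : (0 : rat) < #|W|%:R by rewrite ltr0n; apply/card_gt0P; exists w.
rewrite -(ler_pM2l W0).
have del u : u \in W -> \sum_(v in W :\ u) share (nb v :&: W :\ u) + (gain (nb u :&: W))%:R <= (rho W)%:R.
  move=> uW; apply: le_trans (_ : (rho (W :\ u))%:R + (gain (nb u :&: W))%:R <= _); last first.
    by rewrite -natrD ler_nat rho_del.
  rewrite lerD2r; have := IH (W :\ u); rewrite (cardsD1 u) uW in leW.
  move/(_ leW); apply: le_trans; rewrite le_eqVlt; apply/orP; left; apply/eqP.
  by apply: eq_bigr => v _; rewrite setIDA.
(* Average over the removed vertex: outside [v |: M] it leaves the share of [v] unchanged; the
   remaining cases are [share_step]. *)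
have key v : v \in W -> #|W|%:R * share (nb v :&: W) <=
    \sum_(u in W :\ v) share (nb v :&: W :\ u) + (gain (nb v :&: W))%:R.
  move=> vW; set M := nb v :&: W.
  have sM : M \subset W :\ v.
    by rewrite subsetD1 subsetIr inE (negbTE (nb_irr v)).
  have := share_step (subsetIl (nb v) W); rewrite -/M => step.
  rewrite (big_setID M) /= (setIidPr sM).
  rewrite [X in _ + X + _](eq_bigr (fun=> share M)); last first.
    move=> u /setDP [_ uM]; congr share; apply/setDidPl.
    by rewrite disjoint_sym disjoints1.
  have cW : (#|W| = #|M|.+1 + #|W :\ v :\: M|)%N.
    by rewrite (cardsD1 v) vW -(cardsID M (W :\ v)) (setIidPr sM); lia.
  rewrite sumr_const cW natrD mulrDl (mulr_natl _ #|W :\ v :\: M|) [X in _ <= X]addrAC lerD2r.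
  by rewrite [X in _ <= X]addrC.
have -> : #|W|%:R * (rho W)%:R = \sum_(u in W) (rho W)%:R :> rat.
  by rewrite sumr_const mulr_natl.
rewrite mulr_sumr; apply: le_trans (ler_sum _ key) _; apply: le_trans (ler_sum _ del).
rewrite !big_split /= lerD2r le_eqVlt; apply/orP; left; apply/eqP.
rewrite (exchange_big_dep (mem W)) /=; last by move=> u v _; rewrite !inE => /andP [].
apply: eq_bigr => u uW; apply: eq_bigl => v; rewrite !inE uW andbT eq_sym.
by rewrite andbC.
Qed.
End Averaging.

(** * Closed edge sets in highly connected graphs *)

Section RankClosure.
Variables (T : finType) (r : {set T} -> nat).
Hypothesis rr : rank_fun r.
Implicit Types (A F : {set T}).

Lemma rk_spanS x F F' : F \subset F' -> r (x |: F) = r F -> r (x |: F') = r F'.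
Proof.
move=> sF rF; apply/eqP; rewrite eqn_leq (rkS rr (subsetUr [set x] F')) andbT.
have := rkUI rr (x |: F) F'; rewrite -setUA (setUidPr sF) rF.
have : r F <= r ((x |: F) :&: F') by rewrite (rkS rr) // subsetI subsetUr.
lia.
Qed.

Lemma rk_spanU F A : (forall x, x \in A -> r (x |: F) = r F) -> r (F :|: A) = r F.
Proof.
have [n] := ubnP #|A|; elim: n A => // n IH A leA hA.
have [->|[x xA]] := set_0Vmem A; first by rewrite setU0.
move: leA; rewrite (cardsD1 x) xA add1n => leA.
rewrite -{1}(setD1K xA) setUCA (rk_spanS (F := F)) ?subsetUl ?hA //.
by apply: IH leA _ => y; rewrite inE => /andP [_ /hA].
Qed.
End RankClosure.

Lemma connect_homo (T T' : finType) (e : rel T) (e' : rel T') (f : T -> T') :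
  (forall x y, e x y -> connect e' (f x) (f y)) ->
  forall x y, connect e x y -> connect e' (f x) (f y).
Proof.
move=> h x y /connectP [p]; elim: p x => [|z p IH] x /=; first by move=> _ ->.
move=> /andP [xz /IH zp] /zp; exact/connect_trans/h.
Qed.

Section Graph.
Variable V : finType.
Implicit Types (E H F : {set {set V}}) (W M B S : {set V}) (u v x y : V) (e : {set V}).

Definition induced E W := [set e in E | e \subset W].
Definition nbrs E v := [set u | (u != v) && ([set v; u] \in E)].
Definition is_clique E : pred {set V} :=
  fun M => [forall x in M, forall y in M, (x != y) ==> ([set x; y] \in E)].

Lemma is_cliqueP E M : reflect
  (forall x y, x \in M -> y \in M -> x != y -> [set x; y] \in E) (is_clique E M).
Proof.
apply: (iffP forall_inP) => [h x y xM yM xy|h x xM].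
  by have /forall_inP /(_ y yM) := h x xM; rewrite xy.
by apply/forall_inP => y yM; apply/implyP; exact: h.
Qed.

Lemma is_clique_sub E M M' : M' \subset M -> is_clique E M -> is_clique E M'.
Proof.
by move=> /subsetP sM /is_cliqueP h; apply/is_cliqueP => x y /sM xM /sM yM; exact: h.
Qed.

Lemma mem_complete x y : ([set x; y] \in complete_edges V) = (x != y).
Proof. by rewrite inE cards2 eqSS eqb1. Qed.

Lemma complete_edgeP e : e \in complete_edges V -> exists x y, x != y /\ e = [set x; y].
Proof. by rewrite inE => /cards2P [x [y [xy ->]]]; exists x, y. Qed.

Lemma complete_edge_at e v : e \in complete_edges V -> v \in e ->
  exists2 u, u != v & e = [set v; u].
Proof.
move=> /complete_edgeP [x [y [xy ->]]]; rewrite !inE => /orP [] /eqP ->.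
  by exists y; rewrite // eq_sym.
by exists x; rewrite // setUC.
Qed.

Lemma nbrs_irr E v : v \notin nbrs E v.
Proof. by rewrite inE eqxx. Qed.

Lemma induced_del E W v : E \subset complete_edges V -> v \in W ->
  induced E W = induced E (W :\ v) :|: star v (nbrs E v :&: W).
Proof.
move=> /subsetP sE vW; apply/setP => e; rewrite !inE; apply/andP/orP.
  case=> eE eW; have [ve|ve] := boolP (v \in e).
    right; have [u uv E1] := complete_edge_at (sE _ eE) ve.
    rewrite E1 mem_star // !inE uv -E1 eE /=.
    by apply: (subsetP eW); rewrite E1 set22.
  by left; rewrite eE subsetD1 eW.
case=> [/andP [eE]|/imsetP [u]]; first by rewrite subsetD1 => /andP [].
rewrite !inE => /andP [/andP [uv vuE] uW] ->; split=> //.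
by rewrite subUset !sub1set vW uW.
Qed.

Lemma induced_notin E W v e : e \in induced E (W :\ v) -> v \notin e.
Proof. by rewrite inE subsetD1 => /and3P []. Qed.

Lemma nbrs_complete v : nbrs (complete_edges V) v = [set~ v].
Proof. by apply/setP => u; rewrite in_set mem_complete in_setC1 (eq_sym v) andbb. Qed.

Lemma sum_card_nbrs F W : F \subset complete_edges V ->
  \sum_(v in W) #|nbrs F v :&: W| <= 2 * #|induced F W|.
Proof.
move=> /subsetP sF.
apply: (@leq_trans (\sum_(v in W) #|[set e in induced F W | v \in e]|)).
  apply: leq_sum => v vW; have inj : {in nbrs F v :&: W &, injective (fun u => [set v; u])}.
    move=> u u'; rewrite !inE => /andP [/andP [uv _] _] /andP [/andP [uv' _] _].
    by move=> /eq_set2 [[]|[e _]] //; rewrite e eqxx in uv'.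
  rewrite -(card_in_imset inj); apply/subset_leq_card/subsetP => e /imsetP [u].
  rewrite !inE => /andP [/andP [uv uF] uW] ->.
  by rewrite uF set21 subUset !sub1set vW uW.
under eq_bigr do rewrite -sum1_card.
rewrite (exchange_big_dep (mem (induced F W))) /=; last first.
  by move=> v e _; rewrite inE => /andP [].
rewrite mulnC -sum_nat_const; apply: leq_sum => e eF.
rewrite sum1_card.
have /sF : e \in F by move: eF; rewrite inE => /andP [].
rewrite inE => /eqP <-; apply/subset_leq_card/subsetP => v.
by rewrite -topredE /= => /andP [_]; rewrite inE => /andP [].
Qed.

(** Connectivity of the subgraph induced on [W], kept on the vertex type [V] so that vertices can be
    deleted without changing the type. *)
Definition kconn k E W : Prop := k < #|W| /\
  forall S, #|S| < k -> forall x y, x \in W :\: S -> y \in W :\: S ->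
    connect [rel u v | [&& [set u; v] \in E, u \in W :\: S & v \in W :\: S]] x y.

(** Otherwise deleting all neighbours of [v] would separate it from some remaining vertex. *)
Lemma kconn_degree k E W v : E \subset complete_edges V -> kconn k E W -> v \in W ->
  k <= #|nbrs E v :&: W|.
Proof.
move=> /subsetP sE [kW conn] vW; rewrite leqNgt; apply/negP => ltk.
set S := nbrs E v :&: W in ltk.
have [y yW yS] : exists2 y, y \in W & y \notin v |: S.
  apply/subsetPn; apply: contraL kW => /subset_leq_card; rewrite -leqNgt => /leq_trans; apply.
  by apply: leq_trans ltk; rewrite cardsU1; case: (_ \notin _).
move: yS; rewrite in_setU1 negb_or => /andP [yv yS].
have vS : v \notin S by rewrite inE (negbTE (nbrs_irr E v)).
have := conn S ltk v y; rewrite !(in_setD _ S) vS vW yS yW => /(_ isT isT).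
move=> /connectP [[|z p] /=]; first by move=> _ /eqP; rewrite (negbTE yv).
move=> /andP [/and3P [vz _]]; rewrite in_setD => /andP [/negP zS zW] _ _; apply: zS.
by rewrite inE zW andbT inE vz andbT eq_sym -mem_complete sE.
Qed.

(* A walk through [v] can be rerouted through a surviving vertex of the clique
   of its neighbours. *)
Lemma kconn_del k E W v : E \subset complete_edges V -> kconn k E W -> v \in W ->
  is_clique E (nbrs E v :&: W) -> k.+1 < #|W| -> kconn k E (W :\ v).
Proof.
move=> sE cW vW /is_cliqueP clq ltW; have kN := kconn_degree sE cW vW.
case: cW => _ conn; split; first by move: ltW; rewrite (cardsD1 v) vW.
move=> S ltS x y; rewrite !inE => /and3P [xS xv xW] /and3P [yS yv yW].
have [z zN zS] : exists2 z, z \in nbrs E v :&: W & z \notin S.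
  apply/subsetPn; apply: contraL ltS => /subset_leq_card; rewrite -leqNgt.
  exact: leq_trans.
pose f u := if u == v then z else u.
have [zv zW] : z != v /\ z \in W by move: zN; rewrite !inE => /andP [/andP []].
have -> : x = f x by rewrite /f (negbTE xv).
have -> : y = f y by rewrite /f (negbTE yv).
apply: connect_homo (conn S ltS x y _ _); rewrite ?inE ?xS ?yS //.
move=> a b /= /and3P [abE]; rewrite !in_setD => /andP [aS aW] /andP [bS bW].
have ab : a != b by rewrite -mem_complete (subsetP sE).
have step c : c \in nbrs E v :&: W -> c \notin S -> z = c \/
   [&& [set z; c] \in E, z \in W :\ v :\: S & c \in W :\ v :\: S].
  move=> cN cS; have [|zc] := eqVneq z c; [by left|right].
  rewrite clq //= !inE zS zv zW cS /=; move: cN; rewrite !inE.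
  by move=> /andP [/andP [-> _] ->].
rewrite /f; have [av|av] := eqVneq a v; have [bv|bv] := eqVneq b v.
- by rewrite connect0.
- have bN : b \in nbrs E v :&: W by rewrite !inE bv -av abE.
  by have [->|h] := step b bN bS; [rewrite connect0 | exact: connect1].
- have aN : a \in nbrs E v :&: W by rewrite !inE av -bv setUC abE.
  have [->|/and3P [h1 h2 h3]] := step a aN aS; first by rewrite connect0.
  by apply: connect1; rewrite /= setUC h1 h2 h3.
- by apply: connect1; rewrite /= abE !inE aS bS av bv aW bW.
Qed.
End Graph.

(** * Generic rank of complete graphs *)

Section CompleteRank.
Variables (R : realType) (d : nat) (V : finType).
Local Notation r := (@generic_rank R d V).
Local Notation rr := (@rank_fun_generic R d V).
Local Notation K := (complete_edges V).
Implicit Types (X B : {set V}).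

Definition complete_rank (m : nat) : nat := \sum_(i < m) minn i d.

Lemma complete_rank_le m : complete_rank m <= d * m.
Proof.
have -> : d * m = \sum_(i < m) d by rewrite sum_nat_const card_ord mulnC.
by apply: leq_sum => i _; rewrite geq_minr.
Qed.

(** At most [d] edges at [v] form a 0-extension. Once there are [d] of them, to [B], any further
    edge [vx] is dependent, being the last edge of the complete graph on [v], [x] and [B]. *)
Lemma generic_rank_del_complete X v : v \in X ->
  r (induced K X) = r (induced K (X :\ v)) + minn #|X :\ v| d.
Proof.
move=> vX; have [B [sB cB]] := subset_of_card (geq_minl #|X :\ v| d).
have sX : nbrs K v :&: X = X :\ v by rewrite nbrs_complete setIC -setDE.
rewrite (induced_del (subxx _) vX) sX; set F := induced K (X :\ v).
have vF e : e \in F -> v \notin e by exact: induced_notin.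
have vB : v \notin B by apply/negP => /(subsetP sB); rewrite !inE eqxx.
apply/eqP; rewrite eqn_leq; apply/andP; split; last first.
  rewrite -cB; apply: leq_trans (generic_rank_extend0 R vF vB _) _.
    by rewrite cB geq_minr.
  by apply: (rkS rr); rewrite setUS // imsetS.
apply: (@leq_trans (r (F :|: star v B))); last first.
  by apply: leq_trans (rkU_card _ _ rr) _; rewrite leq_add2l -cB leq_imset_card.
suff <- : r ((F :|: star v B) :|: star v (X :\ v)) = r (F :|: star v B).
  by apply: (rkS rr); rewrite setUSS // subsetUl.
apply: (rk_spanU rr) => e /imsetP [x xX ->{e}].
have [xB|xB] := boolP (x \in B).
  by rewrite (setUidPr _) // sub1set inE mem_star ?orbT.
have xv : x != v by move: xX; rewrite !inE => /andP [].
have cBd : #|B| = d.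
  rewrite cB; apply/minn_idPr; rewrite leqNgt; apply: contra xB => lt.
  move: cB; rewrite (minn_idPl (ltnW lt)) => cB.
  by rewrite (_ : B = X :\ v) //; apply/eqP; rewrite eqEcard sB cB leqnn.
apply: (@generic_rank_clique R d V _ (v |: (x |: B))).
- by rewrite !cardsU1 !inE negb_or eq_sym xv vB xB cBd.
- by rewrite setU11.
- by rewrite !inE eqxx orbT.
- by rewrite eq_sym.
have KF a b : a \in x |: B -> b \in x |: B -> a != b -> [set a; b] \in F.
  have sxB : x |: B \subset X :\ v by rewrite subUset sub1set xX.
  move=> /(subsetP sxB) aX /(subsetP sxB) bX ab.
  by rewrite inE mem_complete ab subUset !sub1set aX bX.
move=> a b /setU1P [->|aB] /setU1P [->|bB] ab nvx; rewrite inE.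
- by rewrite eqxx in ab.
- case/setU1P: bB nvx => [->|bB _]; first by rewrite eqxx.
  by rewrite mem_star ?orbT.
- case/setU1P: aB nvx => [->|aB _]; first by rewrite setUC eqxx.
  by rewrite setUC mem_star ?orbT.
- by rewrite KF.
Qed.

Lemma generic_rank_complete X : r (induced K X) = complete_rank #|X|.
Proof.
have [n] := ubnP #|X|; elim: n X => // n IH X leX.
have [->|[v vX]] := set_0Vmem X.
  rewrite cards0 /complete_rank big_ord0 -(rk0 rr); congr r; apply/setP => e.
  rewrite !inE subset0; apply/negP => /andP [/eqP ce /eqP e0].
  by rewrite e0 cards0 in ce.
move: leX; rewrite (generic_rank_del_complete vX) (cardsD1 v X) vX add1n ltnS => leX.
by rewrite IH // /complete_rank big_ord_recr.
Qed.
End CompleteRank.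

Section Closed.
Variables (R : realType) (d : nat) (V : finType).
Local Notation r := (@generic_rank R d V).
Local Notation rr := (@rank_fun_generic R d V).
Local Notation K := (complete_edges V).
Variable H : {set {set V}}.
Hypothesis d_gt0 : 0 < d.
Hypothesis sHK : H \subset K.
Hypothesis H_closed : forall e, e \in K -> r (e |: H) = r H -> e \in H.
Implicit Types (W M : {set V}) (v x y : V).

(** Only the pair [uu'] can be missing. It is the last edge of a complete graph on [v], [u], [u']
    and [d - 1] further vertices of [M], so closedness puts it into [H]. *)
Lemma closed_glue v M u u' : M \subset nbrs H v -> d < #|M| ->
  u \in M -> u' \in M -> u != u' -> is_clique H (M :\ u) -> is_clique H (M :\ u') ->
  is_clique H M.
Proof.
move=> /subsetP sM dM uM u'M uu' /is_cliqueP cu /is_cliqueP cu'.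
have [B [sB cB]] : exists B : {set V}, B \subset M :\ u :\ u' /\ #|B| = d.-1.
  by apply: subset_of_card; move: dM; rewrite (cardsD1 u) uM (cardsD1 u') !inE eq_sym uu' u'M /=; lia.
have in_H x y : x \in M -> y \in M -> x != y -> [set x; y] != [set u; u'] -> [set x; y] \in H.
  move=> xM yM xy nuu.
  have [xu|xu] := eqVneq x u.
    have yu' : y != u' by apply: contraNneq nuu => ->; rewrite xu.
    by apply: cu'; rewrite ?inE ?xM ?yM ?yu' ?xu ?uu' // -xu.
  have [yu|yu] := eqVneq y u; last by apply: cu; rewrite ?inE ?xM ?yM ?xu ?yu.
  have xu' : x != u' by apply: contraNneq nuu => ->; rewrite yu setUC.
  by apply: cu'; rewrite ?inE ?xM ?yM ?xu' ?yu ?uu' // -yu.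
have vM x : x \in M -> x != v /\ [set v; x] \in H.
  by move=> /sM; rewrite inE => /andP.
have uu'H : [set u; u'] \in H.
  apply: H_closed; first by rewrite mem_complete.
  have BM x : x \in B -> [/\ x \in M, x != u & x != u'].
    by move=> /(subsetP sB); rewrite !inE => /and3P [].
  have uB : u \notin B by apply/negP => /BM []; rewrite eqxx.
  have u'B : u' \notin B by apply/negP => /BM [_ _]; rewrite eqxx.
  have vB : v \notin u |: (u' |: B).
    rewrite !inE !negb_or; apply/and3P; split.
    - by have [] := vM u uM; rewrite eq_sym.
    - by have [] := vM u' u'M; rewrite eq_sym.
    - by apply/negP => /BM [/vM []]; rewrite eqxx.
  have sub x : x \in u |: (u' |: B) -> x \in M.
    by case/setU1P => [->//|/setU1P [->//|/BM []]].
  apply: (@generic_rank_clique R d V H (v |: (u |: (u' |: B)))) => //.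
  - by rewrite cardsU1 vB cardsU1 !inE negb_or uu' uB cardsU1 u'B cB; lia.
  - by rewrite !inE eqxx orbT.
  - by rewrite !inE eqxx !orbT.
  - move=> a b /setU1P [->|aB] /setU1P [->|bB] ab nuu.
    + by rewrite eqxx in ab.
    + by have [] := vM b (sub _ bB).
    + by rewrite setUC; have [] := vM a (sub _ aB).
    + by apply: in_H; rewrite ?sub.
apply/is_cliqueP => x y xM yM xy; have [->//|] := eqVneq [set x; y] [set u; u'].
exact: in_H.
Qed.

Lemma closed_rank_del W u : u \in W ->
  r (induced H (W :\ u)) + gain d (is_clique H) (nbrs H u :&: W) <= r (induced H W).
Proof.
move=> uW; rewrite (induced_del sHK uW); set F := induced H (W :\ u); set M := _ :&: W.
have uF e : e \in F -> u \notin e by exact: induced_notin.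
have uM : u \notin M by rewrite inE (negbTE (nbrs_irr H u)).
rewrite /gain; case: ifPn => [_|]; last first.
  rewrite negb_or -ltnNge => /andP [dM /negP ncM].
  have [x [y [xM yM xy xyH]]] : exists x y, [/\ x \in M, y \in M, x != y & [set x; y] \notin H].
    apply: boolp.contrapT => none; apply: ncM; apply/is_cliqueP => x y xM yM xy.
    by apply/negPn/negP => xyH; apply: none; exists x, y.
  (* The 1-extension on the missing pair gains [d]; adding [xy] to [F] gains one more because [H] is
     closed and omits [xy]. *)
  have := generic_rank_extend1 R uF xy xM yM uM dM d_gt0.
  apply: leq_trans; rewrite addnS -addSn leq_add2r ltn_neqAle (rkS rr) ?subsetUr // andbT.
  apply: contra xyH => /eqP /esym E; apply: H_closed; first by rewrite mem_complete.
  apply: (rk_spanS rr _ E); apply/subsetP => e; by rewrite inE => /andP [].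
have [B [sB cB]] := subset_of_card (geq_minr d #|M|).
have uB : u \notin B by apply: contra uM; exact: (subsetP sB).
rewrite -cB; apply: leq_trans (generic_rank_extend0 R uF uB _) _.
  by rewrite cB geq_minl.
by apply: (rkS rr); rewrite setUS // imsetS.
Qed.

Lemma closed_share W : (\sum_(v in W) share d (is_clique H) (nbrs H v :&: W) <=
  (r (induced H W))%:R)%R.
Proof.
apply: (@sum_share_le V d (nbrs H) (is_clique H) d_gt0 _ _ _ (fun W => r (induced H W))).
- by move=> M M'; exact: is_clique_sub.
- exact: closed_glue.
- exact: nbrs_irr.
- exact: closed_rank_del.
Qed.
End Closed.

(** * Numerical estimates for the shares at the connectivity bound *)

Section Shares.
Local Open Scope ring_scope.
Variables (t d : nat).
Hypotheses (t_gt0 : (0 < t)%N) (d_gt0 : (0 < d)%N).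
Let t_ge1 : (1 : rat) <= t%:R. Proof. by rewrite ler1n. Qed.
Let d_ge1 : (1 : rat) <= d%:R. Proof. by rewrite ler1n. Qed.
Let kE : (t * d * (d + 1))%:R = t%:R * d%:R * (d%:R + 1) :> rat.
Proof. by rewrite !natrM natrD. Qed.

Lemma share0_small_degree m s : (m < t * d * (d + 1))%N -> (t * d * (d + 1) <= m + s)%N ->
  d%:R <= share0 d m + s%:R / (2 * t)%:R.
Proof.
have [t1 d1] := (t_ge1, d_ge1); move=> mk ks; have m0 : (m%:R : rat) >= 0 by exact: ler0n.
have mk' : (m%:R + 1 : rat) <= t%:R * d%:R * (d%:R + 1).
  by rewrite natr1 -kE ler_nat.
have ks' : t%:R * d%:R * (d%:R + 1) <= m%:R + s%:R :> rat.
  by rewrite -kE -natrD ler_nat.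
rewrite -subr_ge0 /share0; case: ltnP => [md|dm].
  have -> : m%:R / 2%:R + s%:R / (2 * t)%:R - d%:R =
      (m%:R * t%:R + s%:R - 2%:R * d%:R * t%:R) / (2%:R * t%:R) :> rat.
    by rewrite natrM; field; lra.
  (* Since [s >= t * d * (d + 1) - m], the numerator is at least the sum of the terms in [h1] and
     [h2]. *)
  have h1 : 0 <= m%:R * (t%:R - 1) :> rat by apply: mulr_ge0; lra.
  have h2 : 0 <= t%:R * (d%:R * (d%:R - 1)) :> rat.
    by apply: mulr_ge0; [lra | apply: mulr_ge0; lra].
  by apply: divr_ge0; lra.
have -> : d%:R - (d * d.+1)%:R / (2 * m.+1)%:R + s%:R / (2 * t)%:R - d%:R =
    (s%:R * (m%:R + 1) - t%:R * d%:R * (d%:R + 1)) / (2%:R * t%:R * (m%:R + 1)) :> rat.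
  by rewrite !natrM -!natr1; field; lra.
(* With [k = t * d * (d + 1)], the numerator is at least
   [(k - m) * (m + 1) - k = m * (k - m - 1)]. *)
by apply: divr_ge0; nra.
Qed.

Lemma share0_large_degree m s : (t * d * (d + 1) <= m)%N -> (0 < s)%N ->
  d%:R <= share0 d m + s%:R / (2 * t)%:R.
Proof.
have [t1 d1] := (t_ge1, d_ge1); move=> mk s0; have m0 : (m%:R : rat) >= 0 by exact: ler0n.
have dm : (d <= m)%N by nia.
have mk' : t%:R * d%:R * (d%:R + 1) <= (m%:R : rat) by rewrite -kE ler_nat.
have s1 : (1 : rat) <= s%:R by rewrite ler1n.
rewrite -subr_ge0 /share0 ltnNge dm /=.
have -> : d%:R - (d * d.+1)%:R / (2 * m.+1)%:R + s%:R / (2 * t)%:R - d%:R =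
    (s%:R * (m%:R + 1) - t%:R * d%:R * (d%:R + 1)) / (2%:R * t%:R * (m%:R + 1)) :> rat.
  by rewrite !natrM -!natr1; field; lra.
by apply: divr_ge0; nra.
Qed.

Lemma share1_large_degree m : (t * d * (d + 1) <= m)%N -> d%:R <= share1 d m.
Proof.
have [t1 d1] := (t_ge1, d_ge1); move=> mk; have mk' : t%:R * d%:R * (d%:R + 1) <= (m%:R : rat) by rewrite -kE ler_nat.
have m1 : (m%:R : rat) >= d%:R * (d%:R + 1) by nra.
have m0 : (m%:R : rat) > 0 by nra.
rewrite -subr_ge0 /share1.
have -> : d%:R + 2%:R^-1 - (d * d.+1)%:R / (2 * m)%:R - d%:R =
    (m%:R - d%:R * (d%:R + 1)) / (2%:R * m%:R) :> rat.
  by rewrite !natrM -!natr1; field; lra.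
by apply: divr_ge0; lra.
Qed.
End Shares.

(** * The rank inequality for closed sets and the packing of rigid subgraphs *)

Section Packing.
Variables (R : realType) (d : nat) (V : finType).
Local Notation r := (@generic_rank R d V).
Local Notation rr := (@rank_fun_generic R d V).
Local Notation K := (complete_edges V).
Implicit Types (H E F : {set {set V}}) (W : {set V}).

(** Stated for induced subgraphs so that exceptional vertices can be deleted by induction on [W],
    while [H] stays closed in the matroid on all of [V]. *)
Lemma closed_packing_le t H E W : 0 < t -> 0 < d -> H \subset E -> E \subset K ->
  (forall e, e \in K -> r (e |: H) = r H -> e \in H) ->
  kconn (t * d * (d + 1)) E W ->
  t * r (induced K W) <= #|induced E W :\: H| + t * r (induced H W).
Proof.
move=> t0 d0 sHE sEK Hcl; have sHK := subset_trans sHE sEK.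
have [n] := ubnP #|W|; elim: n W => // n IH W leW kW.
set k := t * d * (d + 1) in kW *.
have dk : d <= k by rewrite /k; nia.
have [/exists_inP [v vW /and3P [kN cN /eqP EN]]|none] := boolP [exists v in W,
   [&& k <= #|nbrs H v :&: W|, is_clique H (nbrs H v :&: W) & nbrs E v :&: W == nbrs H v :&: W]].
  set N := nbrs H v :&: W in kN cN EN.
  have vN : v \notin N by rewrite inE (negbTE (nbrs_irr H v)).
  have sNW : v |: N \subset W by rewrite subUset sub1set vW subsetIr.
  (* If [v] and its neighbours fill [W], then [H] contains every pair in [W] and the rank term alone
     suffices. *)
  have [WN|WN] := eqVneq (v |: N) W.
    apply: leq_trans (leq_addl _ _); rewrite leq_mul2l (rkS rr) ?orbT //.
    apply/subsetP => e; rewrite !in_set => /andP [ce eW]; rewrite eW andbT.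
    have [x [y [xy E1]]] : exists x y, x != y /\ e = [set x; y].
      by apply: complete_edgeP; rewrite inE.
    have /is_cliqueP clq := cN.
    have vx x' : x' \in N -> [set v; x'] \in H by rewrite !inE => /andP [/andP []].
    move: eW; rewrite E1 -WN subUset !sub1set => /andP [] /setU1P [xv|xN] /setU1P [yv|yN].
    - by rewrite xv yv eqxx in xy.
    - by rewrite xv vx.
    - by rewrite yv setUC vx.
    - exact: clq.
  have ltW : k.+1 < #|W|.
    have : #|v |: N| < #|W| by apply: proper_card; rewrite properEneq WN.
    by rewrite cardsU1 vN add1n; apply: leq_ltn_trans.
  have kWv : kconn k E (W :\ v).
    apply: kconn_del => //; rewrite EN; apply/is_cliqueP => x y xN yN xy.
    by apply: (subsetP sHE); move/is_cliqueP: cN; apply.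
  move: leW; rewrite (cardsD1 v) vW add1n => leW.
  (* Deleting [v] lowers the rank of the complete graph by at most [d] and that of [H] by at least
     [d]. *)
  have := IH _ leW kWv; rewrite (generic_rank_del_complete R d vW).
  have := closed_rank_del d0 sHK Hcl vW.
  rewrite -/N /gain cN orbT (minn_idPl (leq_trans dk kN)).
  have : #|induced E (W :\ v) :\: H| <= #|induced E W :\: H|.
    apply/subset_leq_card/setSD/subsetP => e; rewrite !inE subsetD1.
    by case/andP => -> /andP [->].
  have := geq_minr #|W :\ v| d; nia.
(* The number of edges of [E] outside [H] at [v]. Each edge is counted at both ends, hence the
   weight [1 / (2 * t)]. *)
pose s v := #|nbrs (E :\: H) v :&: W|.
have sum_s : \sum_(v in W) s v <= 2 * #|induced E W :\: H|.
  rewrite (_ : induced E W :\: H = induced (E :\: H) W).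
    by apply: sum_card_nbrs; apply: subset_trans sEK; rewrite subsetDl.
  by apply/setP => e; rewrite !inE andbA.
have deg v : v \in W -> k <= #|nbrs H v :&: W| + s v.
  move=> vW; apply: leq_trans (kconn_degree sEK kW vW) _.
  apply: leq_trans (leq_card_setU _ _); apply/subset_leq_card/subsetP => u.
  by rewrite !inE; case: (_ \in H); case: (u == v); case: (_ \in E); case: (u \in W).
have share_ge v : v \in W -> (d%:R <= share d (is_clique H) (nbrs H v :&: W) + (s v)%:R / (2 * t)%:R)%R.
  move=> vW; have := deg v vW; set m := #|_| => ks.
  have sn0 : (0 <= (s v)%:R / (2 * t)%:R :> rat)%R by apply: divr_ge0; exact: ler0n.
  have [mk|km] := ltnP m k.
    apply: (le_trans (share0_small_degree t0 d0 mk ks)); rewrite lerD2r /share -/m.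
    by case: ifPn => //; rewrite negb_or -leqNgt => /andP [dm _]; exact: share0_le1.
  rewrite /share -/m; have [cN|ncN] := boolP (is_clique H _); last first.
    rewrite orbF ltnNge (leq_trans dk km) /=.
    by apply: (le_trans (share1_large_degree t0 d0 km)); rewrite lerDl.
  rewrite orbT; apply: (share0_large_degree t0 d0 km).
  (* Without an edge outside [H], [v] would be an exceptional vertex, already excluded. *)
  rewrite lt0n; apply: contraNneq none => /cards0_eq s0.
  apply/exists_inP; exists v => //; rewrite km cN eqEsubset /=.
  apply/andP; split; last by apply: setSI; apply/subsetP => u; rewrite !inE => /andP [->] /(subsetP sHE).
  apply/subsetP => u; have /setP /(_ u) := s0; rewrite !inE.
  by case: (_ \in H); case: (u == v) => //=; case: (_ \in E); case: (u \in W).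
apply: (@leq_trans (t * (d * #|W|))).
  by rewrite leq_mul2l generic_rank_complete complete_rank_le orbT.
have t0R : (0 < t%:R :> rat)%R by rewrite ltr0n.
have : ((d * #|W|)%:R <= (r (induced H W))%:R + #|induced E W :\: H|%:R / t%:R :> rat)%R.
  rewrite mulnC natrM mulr_natl -sumr_const; apply: (le_trans (ler_sum _ share_ge)).
  rewrite big_split lerD ?closed_share //= -mulr_suml -natr_sum.
  rewrite ler_pdivrMr ?ltr0n ?muln_gt0 ?t0 // natrM mulrCA divfK ?lt0r_neq0 //.
  by rewrite -natrM ler_nat.
rewrite -(ler_pM2l t0R) mulrDr mulrCA divff ?lt0r_neq0 // mulr1.
by rewrite -!natrM -natrD ler_nat addnC.
Qed.

Lemma induced_setT E : induced E setT = E.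
Proof. by apply/setP => e; rewrite !inE subsetT andbT. Qed.

Lemma edges_complete (G : sgraph V) : edges G \subset K.
Proof. by apply/subsetP => e eG; rewrite inE; have /forall_inP := edges_card2 G; apply. Qed.

Lemma rigid_packing t (G : sgraph V) : 0 < t -> 0 < d ->
  kconnected (t * d * (d + 1)) G -> has_disjoint_spanning t (@rigid R d V) G.
Proof.
move=> t0 d0 [kV conn]; set k := t * d * (d + 1) in kV conn.
have sEK := edges_complete G; set E := edges G in sEK.
have key F : F \subset E -> t * r K <= #|E :\: F| + t * r F.
  (* The closure of [F]. Passing from [E] to [E :|: H] preserves connectivity and adds no edge
     outside [H]. *)
  move=> sFE; pose H := [set e in K | r (e |: F) == r F].
  have sFK := subset_trans sFE sEK.
  have sFH : F \subset H.
    apply/subsetP => e eF; rewrite in_set (subsetP sFK) //=; apply/eqP; congr r.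
    by apply/setUidPr; rewrite sub1set.
  have rH : r H = r F.
    rewrite -(setUidPr sFH); apply: (rk_spanU rr) => e.
    by rewrite in_set => /andP [_ /eqP].
  have Hcl e : e \in K -> r (e |: H) = r H -> e \in H.
    move=> eK eH; rewrite in_set eK /= eqn_leq (rkS rr (subsetUr [set e] F)) andbT.
    by rewrite -rH -eH (rkS rr) // setUS.
  have sHK : H \subset K by apply/subsetP => e; rewrite in_set => /andP [].
  have := @closed_packing_le t H (E :|: H) setT t0 d0 (subsetUr _ _) _ Hcl.
  rewrite !induced_setT rH subUset sEK sHK => /(_ isT) h; apply: leq_trans (h _) _; last first.
    by rewrite leq_add2r setDUl setDv setU0 subset_leq_card // setDS.
  split=> [|S ltS x y]; first by rewrite cardsT.
  rewrite !inE !andbT => xS yS; apply: (connect_homo (f := id)) (conn S ltS x y xS yS) => u v /and3P [uv uS vS].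
  by apply: connect1; rewrite /= !inE uS vS [_ \in E]uv.
(* The case [F = E] shows that [E] itself is rigid, so packed sets of rank [r E] are rigid too. *)
have rE : r E = r K.
  apply/eqP; rewrite eqn_leq (rkS rr) //=.
  by have := key E (subxx _); rewrite setDv cards0 add0n leq_pmul2l.
have [|I [sI dI rI]] := @matroid_packing _ r E t rr.
  by rewrite rE.
have I2 i : [forall e in I i, #|e| == 2].
  by apply/forall_inP => e /(subsetP (sI i)) /(subsetP sEK); rewrite inE.
exists (fun i => SGraph (I2 i)); split=> // i.
by rewrite /rigid /= rI rE.
Qed.
End Packing.

(** * Connectivity of rigid graphs and sharpness *)

Lemma complete_rankS d m : complete_rank d m.+1 = complete_rank d m + minn m d.
Proof. by rewrite /complete_rank big_ord_recr. Qed.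

(** The increments [min(i, d)] are nondecreasing in [i], and [s < d] makes the first comparison
    strict. *)
Lemma complete_rank_strict_super d s a b : s < d -> 0 < a -> 0 < b ->
  complete_rank d (b + s) + complete_rank d (a + s) < complete_rank d (a + (b + s)) + complete_rank d s.
Proof.
move=> sd a0; case: b => // b _; elim: b => [|b IH].
  by rewrite add1n addnS !complete_rankS; lia.
by move: IH; rewrite (addSn b.+1 s) addnS !complete_rankS; lia.
Qed.

(** The classical value [d * m - d * (d + 1) / 2], doubled and rearranged to avoid division and
    subtraction. *)
Lemma complete_rank_ge d m : d <= m -> 2 * complete_rank d m + d * (d + 1) = 2 * d * m.
Proof.
elim: m => [|m IH]; first by rewrite leqn0 => /eqP ->; rewrite /complete_rank big_ord0.
rewrite leq_eqVlt => /orP [/eqP ->|]; last first.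
  by rewrite ltnS => dm; have := IH dm; rewrite complete_rankS; nia.
have : 2 * complete_rank m.+1 m.+1 = m.+1 * m.
  rewrite /complete_rank (eq_bigr (fun i : 'I_m.+1 => val i)) => [|i _].
    by rewrite -(big_mkord xpredT (fun i => i)) bin2_sum -(mul_bin_diag m.+1) bin1.
  by apply/minn_idPl; rewrite ltnW.
nia.
Qed.

Section RigidConnected.
Variables (R : realType) (d : nat) (V : finType).
Local Notation r := (@generic_rank R d V).
Local Notation rr := (@rank_fun_generic R d V).
Local Notation K := (complete_edges V).

(** If [S] separates, the graph lies in two complete graphs meeting in [S]; submodularity and strict
    supermodularity of [complete_rank] make its rank too small. *)
Lemma rigid_kconnected (G : sgraph V) : d < #|V| -> rigid R d G -> kconnected d G.
Proof.
move=> dV rG; split=> // S ltS x y xS yS; apply/negPn/negP => nxy.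
set e := [rel u v | _] in nxy.
pose A := [set z | (z \notin S) && connect e x z].
pose B := ~: (A :|: S).
have AS : [disjoint A & S].
  by rewrite -setI_eq0; apply/eqP/setP => z; rewrite !inE; case: (z \in S); rewrite ?andbF.
have BS : [disjoint B & S].
  by rewrite -setI_eq0; apply/eqP/setP => z; rewrite !inE; case: (z \in S); rewrite ?orbT ?andbF.
have sG : edges G \subset induced K (A :|: S) :|: induced K (B :|: S).
  apply/subsetP => f fG; have fK := subsetP (edges_complete G) _ fG.
  rewrite in_setU !in_set (_ : #|f| == 2); last by move: fK; rewrite inE.
  have [fB|/subsetPn [a af aBS]] := boolP (f \subset B :|: S); first by rewrite orbT.
  rewrite orbF /=; apply/subsetP => b bf; rewrite !inE.
  have /andP [aS xa] : (a \notin S) && connect e x a.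
    by move: aBS; rewrite !inE; case: (a \in S); rewrite ?orbT //= orbF negbK orbF.
  have [bS|bS] := boolP (b \in S); rewrite ?orbT // orbF /=.
  have [c ca fE] := complete_edge_at fK af.
  move: bf; rewrite fE !inE => /orP [/eqP -> //|/eqP bc].
  apply: connect_trans xa _; apply: connect1.
  by rewrite /= /adj bc -fE fG aS -bc.
have : r K + r (induced K S) <= r (induced K (A :|: S)) + r (induced K (B :|: S)).
  rewrite -rG; have := rkS rr sG.
  have := rkUI rr (induced K (A :|: S)) (induced K (B :|: S)).
  have : r (induced K S) <= r (induced K (A :|: S) :&: induced K (B :|: S)).
    apply: (rkS rr); apply/subsetP => f; rewrite !inE => /andP [-> fS] /=.
    by rewrite !(subset_trans fS) ?subsetUr.
  lia.
rewrite -[X in r X + _]induced_setT !generic_rank_complete cardsT.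
have cAS : #|A :|: S| = #|A| + #|S| by apply/eqP; rewrite (leq_card_setU A S).2.
have cBS : #|B :|: S| = #|B| + #|S| by apply/eqP; rewrite (leq_card_setU B S).2.
have -> : #|V| = #|A| + (#|B| + #|S|) by rewrite -(cardsC (A :|: S)) cAS -/B; lia.
rewrite cAS cBS.
have A0 : 0 < #|A| by apply/card_gt0P; exists x; rewrite inE xS connect0.
have B0 : 0 < #|B|.
  by apply/card_gt0P; exists y; rewrite !inE negb_or yS andbT /= (negbTE nxy).
have := complete_rank_strict_super ltS A0 B0; lia.
Qed.
End RigidConnected.

(* The vertices of [K_{k,k}] are [(b, i)]; vertex [(b, i)] is inflated to a
   clique [(b, i, j)], whose vertex [j] is joined to the clique [(~~ b, j)]. *)
Section Inflation.
Variable k : nat.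
Local Notation V := (bool * 'I_k * 'I_k)%type.
Implicit Types (x y : V).

Definition inflation_clique (c : bool * 'I_k) : {set V} := [set x | x.1 == c].

Definition inflation_cliques : {set {set V}} :=
  \bigcup_c induced (complete_edges _) (inflation_clique c).

Definition inflation_link (p : 'I_k * 'I_k) : {set V} :=
  [set ((true, p.1), p.2); ((false, p.2), p.1)].

Definition inflation_matching : {set {set V}} := [set inflation_link p | p in setT].

Lemma inflation_card2 :
  [forall e in inflation_cliques :|: inflation_matching, #|e| == 2].
Proof.
apply/forall_inP => e /setUP [/bigcupP [c _]|/imsetP [p _ ->]]; last by rewrite cards2.
by rewrite inE => /andP []; rewrite inE.
Qed.

Definition inflation := SGraph inflation_card2.

Lemma card_inflation : #|{: V}| = 2 * k * k.
Proof. by rewrite !card_prod card_bool card_ord. Qed.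

Lemma inflation_kconnected : 0 < k -> kconnected k inflation.
Proof.
move=> k0; split=> [|S ltS]; first by rewrite card_inflation; nia.
rewrite /connected_minus; set e : rel V := [rel u v | _].
have eE x y : e x y = [&& [set x; y] \in inflation_cliques :|: inflation_matching,
    x \notin S & y \notin S] by [].
have esym : connect_sym e.
  by apply: sym_connect_sym => x y; rewrite !eE setUC [(x \notin S) && _]andbC.
have clique x y : x.1 = y.1 -> x \notin S -> y \notin S -> connect e x y.
  move=> xy xS yS; have [->|nxy] := eqVneq x y; first exact: connect0.
  apply: connect1; rewrite eE xS yS !andbT in_setU; apply/orP; left.
  apply/bigcupP; exists x.1 => //; rewrite in_set mem_complete nxy subUset !sub1set !inE.
  by rewrite xy !eqxx.
have link i j : ((true, i), j) \notin S -> ((false, j), i) \notin S ->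
    connect e ((true, i), j) ((false, j), i).
  move=> iS jS; apply: connect1; rewrite eE iS jS !andbT in_setU; apply/orP; right.
  by apply/imsetP; exists (i, j).
(* Fewer than [k] deleted vertices leave a whole clique on each side untouched,
   together with its links. *)
have avoid (f : V -> 'I_k) : exists j, forall x, f x = j -> x \notin S.
  have : #|f @: S| < #|[set: 'I_k]|.
    by rewrite cardsT card_ord; apply: leq_ltn_trans ltS; exact: leq_imset_card.
  move=> lt; have /subsetPn [j _ jf] : ~~ ([set: 'I_k] \subset f @: S).
    by apply: contraL lt => /subset_leq_card; rewrite -leqNgt.
  exists j => x fx; apply: contra jf => xS; rewrite -fx; exact: imset_f.
have [j0 hj] := avoid (fun x => if x.1.1 then x.2 else x.1.2).
have [i0 hi] := avoid (fun x => if x.1.1 then x.1.2 else x.2).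
pose h : V := ((false, j0), i0).
have hS : h \notin S by apply: hj.
have hub x : x \notin S -> connect e x h.
  case: x => [[[] i] j] xS.
    apply: connect_trans (clique _ ((true, i), j0) _ xS _) _ => //; first exact: hj.
    apply: connect_trans (link i j0 _ _) _; [exact: hj | exact: hj |].
    by apply: clique => //; exact: hj.
  (* The route passes through the clique [(true, i0)], untouched with all its links, and crosses
     back to [h] by the link at [j0]. *)
  apply: connect_trans (clique _ ((false, i), i0) _ xS _) _ => //; first exact: hi.
  rewrite esym.
  apply: connect_trans (link i0 i _ _); [|exact: hi | exact: hi].
  rewrite esym.
  apply: connect_trans (clique _ ((true, i0), j0) _ _ _) _ => //; [exact: hi | exact: hj |].
  by apply: link; exact: hj.
move=> x y xS yS; apply: connect_trans (hub x xS) _; rewrite esym; exact: hub.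
Qed.

(** The cliques have total rank at most [2 * k * complete_rank d k]; each rigid subgraph must make
    up the deficit with matching edges, and disjoint subgraphs share only [k * k] of these. *)
Lemma inflation_not_packing (R : realType) t d : 0 < t -> 1 < d ->
  k = t * d * (d + 1) - 1 -> ~ has_disjoint_spanning t (@rigid R d V) inflation.
Proof.
move=> t0 d1 kE [H [sH dH rH]].
pose rr := @rank_fun_generic R d V; set r := @generic_rank R d V in rr.
have dk : d <= k by rewrite kE; nia.
have rcl : r inflation_cliques <= 2 * k * complete_rank d k.
  have -> : 2 * k * complete_rank d k = \sum_(c : bool * 'I_k) complete_rank d k.
    by rewrite sum_nat_const card_prod card_bool card_ord.
  rewrite /inflation_cliques.
  apply: (big_ind2 (fun (A : {set {set V}}) n => r A <= n)) => [|A m B n rA rB|c _].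
  - by rewrite (rk0 rr).
  - have := rkUI rr A B; lia.
  rewrite /r generic_rank_complete (_ : #|inflation_clique c| = k) //.
  have -> : inflation_clique c = [set (c, j) | j in [set: 'I_k]].
    apply/setP => -[c' j]; rewrite inE /=; apply/eqP/imsetP => [->|[j' _ [-> _]] //].
    by exists j; rewrite ?inE.
  by rewrite card_imset ?cardsT ?card_ord // => ? ? [].
have rHi i : complete_rank d (2 * k * k) <=
    r inflation_cliques + #|edges (H i) :&: inflation_matching|.
  rewrite -card_inflation -cardsT -(@generic_rank_complete R) induced_setT -(rH i).
  apply: leq_trans (rkU_card _ _ rr); apply: (rkS rr); apply/subsetP => e eH.
  by have := subsetP (sH i) _ eH; rewrite !inE eH.
have sm : \sum_i #|edges (H i) :&: inflation_matching| <= k * k.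
  apply: (@leq_trans #|inflation_matching|); last first.
    by apply: leq_trans (leq_imset_card _ _) _; rewrite cardsT card_prod card_ord.
  under eq_bigr do rewrite -sum1_card.
  rewrite (exchange_big_dep (mem inflation_matching)) /=; last by move=> i e _ /setIP [].
  rewrite -[leqRHS]sum1_card; apply: leq_sum => e eM; rewrite sum1_card.
  apply/card_le1_eqP => i j; rewrite -!topredE /= => /setIP [ei _] /setIP [ej _].
  by apply/eqP; apply: contraTT ei => /dH /disjointFr ->.
have : \sum_(i < t) complete_rank d (2 * k * k) <=
    \sum_(i < t) (r inflation_cliques + #|edges (H i) :&: inflation_matching|).
  by apply: leq_sum => i _; exact: rHi.
rewrite big_split /= !sum_nat_const card_ord => le.
have /complete_rank_ge eX : d <= 2 * k * k by nia.
have ec := complete_rank_ge dk.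
have tD : t * (d * (d + 1)) = k + 1 by rewrite mulnA kE; nia.
move: (complete_rank d (2 * k * k)) (complete_rank d k) eX ec rcl le => X c eX ec rcl le.
have le' : t * X <= t * (2 * k * c) + k * k.
  by apply: leq_trans le _; rewrite leq_add // leq_mul2l rcl orbT.
have eX' : 2 * (t * X) + (k + 1) = 4 * (t * d * k * k).
  by rewrite -tD; have := congr1 (muln t) eX; lia.
have ec' : 2 * (t * (2 * k * c)) + 2 * k * (k + 1) = 4 * (t * d * k * k).
  by rewrite -tD; have := congr1 (muln (2 * k * t)) ec; lia.
(* The [t] deficits of [(2 * k - 1) * d * (d + 1) / 2] total [(2 * k - 1) * (k + 1) / 2], which
   exceeds [k * k] once [k > 1]. *)
have : 1 * 2 * 3 <= t * d * (d + 1) by rewrite !leq_mul ?addn1.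
lia.
Qed.
End Inflation.

Theorem corollary1p4 (R : realType) (t : nat) (ht : (0 < t)%N) :
  (forall d : nat, (2 <= d)%N ->
     (forall (V : finType) (G : sgraph V),
        kconnected (t * d * (d + 1)) G ->
        has_disjoint_spanning t (@rigid R d V) G) /\
     (exists (V : finType) (G : sgraph V),
        kconnected (t * d * (d + 1) - 1) G /\
        ~ has_disjoint_spanning t (@rigid R d V) G))
  /\
  (forall k : nat, (0 < k)%N ->
     (forall (V : finType) (G : sgraph V),
        kconnected (t * k * (k + 1)) G ->
        has_disjoint_spanning t (@kconnected k V) G) /\
     (exists fstar : nat, is_fstar k fstar /\ (fstar <= k * (k + 1))%N)).
Proof.
(* [k]-rigid subgraphs are [k]-connected; the packing holds in every positive dimension, so [k = 1]
   is covered. *)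
have packing k s (V : finType) (G : sgraph V) : 0 < k -> 0 < s ->
    kconnected (s * k * (k + 1)) G -> has_disjoint_spanning s (@kconnected k V) G.
  move=> k0 s0 cG; have [H [sH dH rH]] := rigid_packing R s0 k0 cG.
  exists H; split=> // i; apply: rigid_kconnected (rH i).
  by case: cG => cV _; apply: leq_trans cV; nia.
split=> [d d2|k k0]; split.
- by move=> V G; apply: rigid_packing => //; apply: ltnW.
- pose k := t * d * (d + 1) - 1; exists _, (inflation k); split.
    by apply: inflation_kconnected; rewrite /k; nia.
  exact: inflation_not_packing.
- by move=> V G; exact: packing.
have bound : fstar_bound k (k * (k + 1)).
  by move=> s s0 V G; rewrite mulnA; exact: packing.
(* Classical reflection makes the bound a boolean predicate, so that [ex_minn] can pick its least
   positive value. *)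
pose P m := (0 < m) && boolp.asbool (fstar_bound k m).
have exP : exists m, P m.
  by exists (k * (k + 1)); rewrite /P muln_gt0 k0 addn1 /=; apply/boolp.asboolP; rewrite -addn1.
exists (ex_minn exP); case: ex_minnP => m /andP [m0 /boolp.asboolP mb] min; split.
  by split=> // n n0 /boolp.asboolP nb; apply: min; rewrite /P n0.
by apply: min; rewrite /P muln_gt0 k0 addn1 /=; apply/boolp.asboolP; rewrite -addn1.
Qed.
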